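(* There is a constant $c$ such that for all positive integers $k,l,s$ with $k\ge s+l2^{s}$ there are strings $x,y$ of length $n=(2^{s}+1)k$ such that $$CC_I^{c}(x,y)\le 2^{s}\log(2k)\qquad\text{but}\qquad PCC^{s}_{I,\text{1-way}}(x,y)\ge l.$$
   Context: $C(\cdot\mid\cdot)$ denotes plain conditional Kolmogorov complexity with respect to a fixed universal Turing machine. $I(x,y)=y$ is the identity function. A protocol for strings of length $n$ is a deterministic two-party communication protocol (Alice holds $x$, Bob holds $y$, Alice outputs), of complexity $C(P\mid n)$. A total protocol terminates on all inputs. A partial protocol is a pair of programs $(P_A,P_B)$: $P_A$ tells Alice, for each current conversation and her input, to wait for a bit, send a specific bit, or output a string and halt; $P_B$ tells Bob, for each current conversation and his input, to wait, send a bit, or halt; whenever one party is told to send, the other is told to wait, but the programs may give no instruction at all (run forever) on some inputs. For a (total or partial) protocol $P$, $CC^P(x,y)$ is the number of bits exchanged on $(x,y)$ if Alice outputs $y$ on $(x,y)$, and $\infty$ otherwise. $CC^\alpha_I(x,y)$ is the minimum of $CC^P(x,y)$ over all total protocols of complexity at most $\alpha$ (they may be incorrect on other inputs). A one-way protocol is one in which only Bob sends bits; $PCC^\alpha_{I,\text{1-way}}(x,y)$ is the minimum of $CC^P(x,y)$ over all one-way partial protocols of complexity at most $\alpha$. *)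

(* Defs.v *)
(* MathComp world, with MathComp-Analysis for the extended reals and [ln]. *)
From HB Require Import structures.
From mathcomp Require Import all_boot all_order all_algebra.
From mathcomp Require Import all_classical all_reals all_analysis.

Set Implicit Arguments.
Unset Strict Implicit.
Unset Printing Implicit Defensive.

Import Order.TTheory GRing.Theory Num.Theory.

(* [None] is the blank. *)
Definition symbol : finType := option bool.

(* [Some true]: right, [Some false]: left, [None]: stay. *)
Definition move : finType := option bool.

(* Transition table of a deterministic Turing machine with states ['I_q.+1]
   (initial state [ord0]) and [m.+3] two-way infinite tapes.  The machine halts
   where the table is undefined. *)
Definition TM_table (q m : nat) : countType :=
  {ffun 'I_q.+1 * {ffun 'I_m.+3 -> symbol} ->
        option ('I_q.+1 * {ffun 'I_m.+3 -> symbol * move})}.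

Definition TM : countType := {qm : nat * nat & TM_table qm.1 qm.2}.

(* [(l, r)]: the head scans the first symbol of [r], [l] lists the cells to its
   left starting with the nearest one; unlisted cells are blank. *)
Definition tape : Type := seq symbol * seq symbol.

Definition tape_read (t : tape) : symbol := head None t.2.

Definition tape_act (am : symbol * move) (t : tape) : tape :=
  let: (l, r) := (t.1, am.1 :: behead t.2) in
  match am.2 with
  | None => (l, r)
  | Some true => (head None r :: l, behead r)
  | Some false => (behead l, head None l :: r)
  end.

Definition tape_of_bits (w : bitseq) : tape := ([::], map some w).

Fixpoint leading_bits (r : seq symbol) : bitseq :=
  if r is Some b :: r' then b :: leading_bits r' else [::].

Section Machine.
Variable M : TM.
Let q := (tag M).1.
Let m := (tag M).2.

Definition config : Type := 'I_q.+1 * {ffun 'I_m.+3 -> tape}.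

Definition TM_step (c : config) : option config :=
  omap (fun a : 'I_q.+1 * {ffun 'I_m.+3 -> symbol * move} =>
          (a.1, [ffun i => tape_act (a.2 i) (c.2 i)]))
       (tagged M (c.1, [ffun i => tape_read (c.2 i)])).

(* Tape 0 holds the program [p], tape 1 the condition [z]. *)
Definition TM_init (p z : bitseq) : config :=
  (ord0, [ffun i : 'I_m.+3 => tape_of_bits (nth [::] [:: p; z] i)]).

(* The output is read off tape 2, from the head up to the first blank. *)
Definition TM_output (c : config) : bitseq :=
  leading_bits (c.2 (inord 2)).2.

Definition TM_computes (p z u : bitseq) : Prop :=
  exists t c, [/\ iter t (obind TM_step) (Some (TM_init p z)) = Some c,
                  TM_step c = None & TM_output c = u].

End Machine.

(* [univ e z u]: on program [e] and condition [z], the universal machine halts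
   with output [u].  The machines are numbered T_1, T_2, ... (the machine [M] has
   number [(pickle M).+1]), and on program 1^i 0 p the universal machine
   simulates T_i on p; on programs of any other form it does not halt. *)
Definition univ (e z u : bitseq) : Prop :=
  exists (M : TM) (p : bitseq),
    e = nseq (pickle M).+1 true ++ false :: p /\ TM_computes M p z u.

Lemma univ_universal (M : TM) :
  exists c : nat, forall p z u, TM_computes M p z u ->
    exists2 e, (size e <= size p + c)%N & univ e z u.
Proof.
exists (pickle M).+2 => p z u h.
exists (nseq (pickle M).+1 true ++ false :: p); last by exists M, p.
by rewrite size_cat size_nseq /= addnC addSnnS.
Qed.

(* Self-delimiting pairing 1^|u| 0 u v. *)
Definition bit_pair (u v : bitseq) : bitseq :=
  nseq (size u) true ++ false :: u ++ v.

Inductive instruction : Type :=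
  | Wait
  | Send of bool
  | Halt of bitseq.

Definition decode_instruction (u : bitseq) : option instruction :=
  match u with
  | [::] => Some Wait
  | [:: false; b] => Some (Send b)
  | true :: z => Some (Halt z)
  | _ => None
  end.

(* [told p w v i]: program [p] gives the instruction [i] to a party with input
   [v] when the conversation so far is [w]. *)
Definition told (p w v : bitseq) (i : instruction) : Prop :=
  exists2 u, univ p (bit_pair w v) u & decode_instruction u = Some i.

(* Alice's program and Bob's program.  Only Alice's output counts: the string
   carried by an instruction [Halt] to Bob is ignored. *)
Definition program_pair : Type := bitseq * bitseq.

(* [conversation P x y w]: the string [w] of bits, in the order sent, is reached
   in the run of [P] on [(x, y)]. *)
Inductive conversation (P : program_pair) (x y : bitseq) : bitseq -> Prop :=
  | Conv_nil : conversation P x y [::]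
  | Conv_Alice w b : conversation P x y w ->
      told P.1 w x (Send b) -> told P.2 w y Wait ->
      conversation P x y (rcons w b)
  | Conv_Bob w b : conversation P x y w ->
      told P.1 w x Wait -> told P.2 w y (Send b) ->
      conversation P x y (rcons w b).

(* A party may also be given no instruction at all while the other sends; the run
   is then stuck. *)
Definition partial_protocol (n : nat) (P : program_pair) : Prop :=
  forall (x y : n.-tuple bool) (w : bitseq), conversation P x y w ->
    (forall b i, told P.1 w x (Send b) -> told P.2 w y i -> i = Wait) /\
    (forall b i, told P.2 w y (Send b) -> told P.1 w x i -> i = Wait).

Definition total_protocol (n : nat) (P : program_pair) : Prop :=
  partial_protocol n P /\
  forall x y : n.-tuple bool, exists w : bitseq,
    [/\ conversation P x y w,
        exists z, told P.1 w x (Halt z) &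
        exists z, told P.2 w y (Halt z)].

Definition one_way_protocol (n : nat) (P : program_pair) : Prop :=
  partial_protocol n P /\
  forall (x y : n.-tuple bool) (w : bitseq), conversation P x y w ->
    forall b, ~ told P.1 w x (Send b).

Section Complexities.
Variable R : realType.
Local Open Scope classical_set_scope.
Local Open Scope ring_scope.
Local Open Scope ereal_scope.

(* Minimum of a set of natural numbers, [+oo] for the empty set. *)
Definition nat_min (A : set nat) : \bar R := ereal_inf [set i%:R%:E | i in A].

Definition C (u z : bitseq) : \bar R := nat_min [set size p | p in [set p | univ p z u]].

(* The condition [n] is given in unary. *)
Definition protocol_complexity (n : nat) (P : program_pair) : \bar R :=
  C (bit_pair P.1 P.2) (nseq n true).

(* For a protocol [P], Alice gives an output after at most one conversation. *)
Definition CC_of (f : bitseq -> bitseq -> bitseq) (P : program_pair)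
    (x y : bitseq) : \bar R :=
  nat_min [set size w |
           w in [set w | conversation P x y w /\ told P.1 w x (Halt (f x y))]].

Definition CC (f : bitseq -> bitseq -> bitseq) (alpha n : nat)
    (x y : n.-tuple bool) : \bar R :=
  ereal_inf [set CC_of f P x y |
             P in [set P | total_protocol n P /\
                           protocol_complexity n P <= alpha%:R%:E]].

Definition PCC_one_way (f : bitseq -> bitseq -> bitseq) (alpha n : nat)
    (x y : n.-tuple bool) : \bar R :=
  ereal_inf [set CC_of f P x y |
             P in [set P | one_way_protocol n P /\
                           protocol_complexity n P <= alpha%:R%:E]].

Definition log2 (r : R) : R := (ln r / ln 2)%R.

End Complexities.

Definition Id_fun (x y : bitseq) : bitseq := y.

(* Main.v *)
Require Import Defs.
From mathcomp Require Import all_boot all_order all_algebra.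
From mathcomp Require Import all_classical all_reals all_analysis.
From mathcomp Require Import zify.

Set Implicit Arguments.
Unset Strict Implicit.
Unset Printing Implicit Defensive.

(* Lower bound.  There are fewer than M = 2^(s-3) programs of length at most s on
   which the universal machine can halt.  For a one-way protocol the first l-1
   bits sent by Bob depend on y only, so by pigeonhole M strings z of length k
   can be chosen such that, for each of these programs, Bob sends the same bits
   on all inputs y = z00...0.  Whatever x is, each program then makes Alice
   output at most one of the M strings after fewer than l bits, and some y is
   never output.

   Upper bound.  Some M - 1 coordinates separate the M strings.  The string x lists
   the binary addresses of these coordinates, followed by a table that gives
   for each answer vector the corresponding z.  Alice sends the addresses, Bob
   answers each of them with one bit, and Alice looks up z.  The two programs do
   not depend on k, l, s: the turns are determined by the conversation, and all
   the rest is read off x and y.  They are written in a language of loops over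
   stacks of bits, compiled to Turing machines whose tapes are the stacks. *)

(** * Stack programs and their compilation to Turing machines *)

Lemma leading_bits_map (w : bitseq) b :
  leading_bits (map some w ++ nseq b None) = w.
Proof. by elim: w => [|a w IH] /=; [case: b | rewrite IH]. Qed.

(** Blanks are allowed on both sides because a pop leaves one on the left and rewriting the scanned
    blank of an empty stack can add one on the right. *)
Definition stack_tape (t : tape) (w : bitseq) : Prop :=
  exists a b, t = (nseq a None, map some w ++ nseq b None).

Lemma tape_read_stack t w : stack_tape t w -> tape_read t = ohead w.
Proof. by move=> [a [b ->]]; case: w => //; case: b. Qed.

Lemma stack_tape_of_bits w : stack_tape (tape_of_bits w) w.
Proof. by exists 0, 0; rewrite /= cats0. Qed.

Lemma stack_tape_stay t w :
  stack_tape t w -> stack_tape (tape_act (tape_read t, None) t) w.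
Proof.
move=> [a [b ->]]; case: w => [|c w]; last by exists a, b.
by exists a, b.-1.+1; case: b.
Qed.

Lemma stack_tape_pop t c w :
  stack_tape t (c :: w) -> stack_tape (tape_act (None, Some true) t) w.
Proof. by move=> [a [b ->]]; exists a.+1, b. Qed.

(** A transition writes before it moves, so a push takes two steps: move left onto a blank, then
    write. *)
Lemma stack_tape_push t w c : stack_tape t w ->
  stack_tape (tape_act (Some c, None) (tape_act (tape_read t, Some false) t))
    (c :: w).
Proof.
move=> [a [b ->]]; exists a.-1.
case: w => [|d w] /=; last by exists b; case: a.
by exists b.-1.+1; case: a; case: b.
Qed.

(** The only loop drains a stack bit by bit, so every program halts and [exec] can be a total
    function. *)
Inductive prog : Type :=
  | Skip
  | Push of nat & bool
  | Seq of prog & prog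
  | Case of nat & prog & prog & prog
  | Drain of nat & prog & prog.

Notation "p ;; q" := (Seq p q) (at level 60, right associativity).

Definition stacks : Type := seq bitseq.

Definition stack (S : stacks) (i : nat) : bitseq := nth [::] S i.

(* In [Drain i p0 p1] the loop body runs on a state where stack [i] is empty;
   this is faithful only for bodies that do not touch stack [i], see [wf]. *)
Fixpoint exec (p : prog) (S : stacks) : stacks :=
  match p with
  | Skip => S
  | Push i b => set_nth [::] S i (b :: stack S i)
  | Seq p q => exec q (exec p S)
  | Case i p0 p1 pe =>
      if stack S i is b :: w
      then (if b then exec p1 else exec p0) (set_nth [::] S i w)
      else exec pe S
  | Drain i p0 p1 =>
      foldl (fun S b => (if b then exec p1 else exec p0) S)
        (set_nth [::] S i [::]) (stack S i)
  end.

Fixpoint avoids (i : nat) (p : prog) : bool :=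
  match p with
  | Skip => true
  | Push j _ => j != i
  | Seq p q => avoids i p && avoids i q
  | Case j p0 p1 pe => [&& j != i, avoids i p0, avoids i p1 & avoids i pe]
  | Drain j p0 p1 => [&& j != i, avoids i p0 & avoids i p1]
  end.

Fixpoint wf (n : nat) (p : prog) : bool :=
  match p with
  | Skip => true
  | Push i _ => i < n
  | Seq p q => wf n p && wf n q
  | Case i p0 p1 pe => [&& i < n, wf n p0, wf n p1 & wf n pe]
  | Drain i p0 p1 =>
      [&& i < n, wf n p0, wf n p1, avoids i p0 & avoids i p1]
  end.

Lemma set_set_nth_same (T : Type) (x0 : T) s i x y :
  set_nth x0 (set_nth x0 s i x) i y = set_nth x0 s i y.
Proof. by rewrite set_set_nth eqxx. Qed.

Lemma size_set_nth_lt (T : Type) (x0 : T) s i x :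
  i < size s -> size (set_nth x0 s i x) = size s.
Proof. by move=> h; rewrite size_set_nth; apply/maxn_idPr. Qed.

Lemma size_foldl (T A : Type) (f : seq T -> A -> seq T) (s : seq T) (w : seq A) n :
  (forall s a, size s = n -> size (f s a) = n) ->
  size s = n -> size (foldl f s w) = n.
Proof. by move=> hf; elim: w s => //= a w IH s hs; apply/IH/hf. Qed.

Lemma size_exec n p S : wf n p -> size S = n -> size (exec p S) = n.
Proof.
elim: p S => [|i b|p IHp q IHq|i p0 IH0 p1 IH1 pe IHe|i p0 IH0 p1 IH1] S //=.
- by move=> hi hS; rewrite size_set_nth_lt ?hS.
- by move=> /andP[hp hq] hS; apply/IHq/IHp.
- move=> /and4P[hi h0 h1 he] hS.
  case: (stack S i) => [|b w]; first exact: IHe.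
  by case: b; [apply: IH1|apply: IH0] => //; rewrite size_set_nth_lt ?hS.
- move=> /and5P[hi h0 h1 _ _] hS.
  apply: size_foldl => [s a hs|]; first by case: a; [apply: IH1|apply: IH0].
  by rewrite size_set_nth_lt ?hS.
Qed.

Lemma set_nthC (T : Type) (x0 : T) s i j x y : i != j ->
  set_nth x0 (set_nth x0 s i x) j y = set_nth x0 (set_nth x0 s j y) i x.
Proof. by move=> h; rewrite set_set_nth (negPf h). Qed.

(** Needed for loops: the compiled loop keeps the unread bits on stack [i], whereas [exec] empties
    that stack before the first pass. *)
Lemma exec_avoids i p S w :
  avoids i p -> exec p (set_nth [::] S i w) = set_nth [::] (exec p S) i w.
Proof.
have nthE T j v : j != i -> stack (set_nth [::] T i v) j = stack T j.
  by move=> h; rewrite /stack nth_set_nth /= (negPf h).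
elim: p S => [|j b|p IHp q IHq|j p0 IH0 p1 IH1 pe IHe|j p0 IH0 p1 IH1] S //=.
- by move=> h; rewrite nthE // set_nthC // eq_sym.
- by move=> /andP[hp hq]; rewrite IHp // IHq.
- move=> /and4P[hj h0 h1 he]; rewrite nthE //.
  case: (stack S j) => [|b v]; first exact: IHe.
  by rewrite set_nthC 1?eq_sym //; case: b; [apply: IH1|apply: IH0].
- move=> /and3P[hj h0 h1]; rewrite nthE //.
  rewrite set_nthC 1?eq_sym //.
  elim: (stack S j) (set_nth [::] S j [::]) => [|b v IH] T //=.
  by rewrite -IH; case: b; rewrite ?IH0 ?IH1.
Qed.

Section Compile.
Variable m : nat.

Definition instr : Type :=
  {ffun 'I_m.+3 -> symbol} -> nat * {ffun 'I_m.+3 -> symbol * move}.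

Definition act_at (i : nat) (a : symbol * move) (r : {ffun 'I_m.+3 -> symbol}) :
    {ffun 'I_m.+3 -> symbol * move} :=
  [ffun j : 'I_m.+3 => if val j == i then a else (r j, None)].

Definition jump (l : nat) : instr := fun r => (l, [ffun j => (r j, None)]).

Definition move_left (i l : nat) : instr :=
  fun r => (l, [ffun j : 'I_m.+3 =>
                  (r j, if val j == i then Some false else None)]).

Definition write (i : nat) (b : bool) (l : nat) : instr :=
  fun r => (l, act_at i (Some b, None) r).

Definition pop_case (i l0 l1 le : nat) : instr :=
  fun r => match r (inord i) with
           | Some b => (if b then l1 else l0, act_at i (None, Some true) r)
           | None => jump le r
           end.

Fixpoint code_size (p : prog) : nat :=
  match p with
  | Skip => 0
  | Push _ _ => 2
  | Seq p q => code_size p + code_size q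
  | Case _ p0 p1 pe => (code_size p0 + (code_size p1 + code_size pe).+1).+2
  | Drain _ p0 p1 => (code_size p0 + (code_size p1).+1).+2
  end.

(* [a] is the address of the first instruction of [compile p a]. *)
Fixpoint compile (p : prog) (a : nat) : seq instr :=
  match p with
  | Skip => [::]
  | Push i b => [:: move_left i a.+1; write i b a.+2]
  | Seq p q => compile p a ++ compile q (a + code_size p)
  | Case i p0 p1 pe =>
      let a0 := a.+1 in
      let a1 := (a0 + code_size p0).+1 in
      let ae := (a1 + code_size p1).+1 in
      let z := ae + code_size pe in
      pop_case i a0 a1 ae :: compile p0 a0 ++
      jump z :: compile p1 a1 ++ jump z :: compile pe ae
  | Drain i p0 p1 =>
      let a0 := a.+1 in
      let a1 := (a0 + code_size p0).+1 in
      let z := (a1 + code_size p1).+1 in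
      pop_case i a0 a1 z :: compile p0 a0 ++
      jump a :: compile p1 a1 ++ [:: jump a]
  end.

Lemma size_compile p a : size (compile p a) = code_size p.
Proof.
elim: p a => [|i b|p IHp q IHq|i p0 IH0 p1 IH1 pe IHe|i p0 IH0 p1 IH1] a //=.
- by rewrite size_cat IHp IHq.
- by rewrite size_cat /= size_cat /= IH0 IH1 IHe; lia.
- by rewrite size_cat /= size_cat /= IH0 IH1; lia.
Qed.

(** States are instruction addresses. The additional state [size c] has no transition, so reaching
    the end of the code is halting. *)
Definition code_table (c : seq instr) : TM_table (size c) m :=
  [ffun sr => if (val sr.1 < size c)%N
    then let a := nth (jump 0) c (val sr.1) sr.2 in Some (inord a.1, a.2)
    else None].

Definition code_TM (c : seq instr) : TM :=
  Tagged (fun qm => TM_table qm.1 qm.2) (code_table c : TM_table (size c, m).1 (size c, m).2).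

Definition tapes : Type := {ffun 'I_m.+3 -> tape}.

Definition holds (T : tapes) (S : stacks) : Prop :=
  size S = m.+3 /\ forall i : 'I_m.+3, stack_tape (T i) (stack S i).

Definition steps (c : seq instr) (a : nat) (T : tapes) (b : nat) (U : tapes) :=
  exists t, iter t (obind (@TM_step (code_TM c)))
    (Some ((inord a, T) : config (code_TM c))) = Some (inord b, U).

Lemma steps_refl c a T : steps c a T a T.
Proof. by exists 0. Qed.

Lemma steps_trans c a T b U d V :
  steps c a T b U -> steps c b U d V -> steps c a T d V.
Proof. by move=> [t ht] [u hu]; exists (u + t); rewrite iterD ht. Qed.

Lemma step_instr c a (T : tapes) f : a < size c -> nth (jump 0) c a = f ->
  let r := [ffun i : 'I_m.+3 => tape_read (T i)] in
  steps c a T (f r).1 [ffun i : 'I_m.+3 => tape_act ((f r).2 i) (T i)].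
Proof.
move=> ha hf r; exists 1; rewrite /= /TM_step /=.
by rewrite ffunE /= inordK ?ha ?hf // ltnS ltnW.
Qed.

Definition code_at (c : seq instr) (a : nat) (s : seq instr) : Prop :=
  exists c1 c2, c = c1 ++ s ++ c2 /\ size c1 = a.

Lemma code_at_cat c a s1 s2 : code_at c a (s1 ++ s2) ->
  code_at c a s1 /\ code_at c (a + size s1) s2.
Proof.
move=> [c1 [c2 [-> <-]]]; split; first by exists c1, (s2 ++ c2); rewrite -!catA.
by exists (c1 ++ s1), c2; rewrite size_cat -!catA.
Qed.

Lemma code_at_cons c a f s : code_at c a (f :: s) ->
  [/\ a < size c, nth (jump 0) c a = f & code_at c a.+1 s].
Proof.
move=> [c1 [c2 [-> <-]]]; split.
- by rewrite size_cat /=; lia.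
- by rewrite nth_cat ltnn subnn.
- by exists (rcons c1 f), c2; rewrite size_rcons cat_rcons; split.
Qed.

Lemma holds_stay T S :
  holds T S -> holds [ffun i : 'I_m.+3 => tape_act (tape_read (T i), None) (T i)] S.
Proof.
by move=> [hs hT]; split=> // i; rewrite ffunE; apply: stack_tape_stay.
Qed.

Lemma steps_jump c a l T S : a < size c -> nth (jump 0) c a = jump l ->
  holds T S -> exists2 U, steps c a T l U & holds U S.
Proof.
move=> ha hf hT; have := step_instr T ha hf; rewrite /= => h.
eexists; first exact: h.
have -> : [ffun i => tape_act ([ffun j => ([ffun i => tape_read (T i)] j, None)] i) (T i)]
   = [ffun i => tape_act (tape_read (T i), None) (T i)].
  by apply/ffunP => i; rewrite !ffunE.
exact: holds_stay.
Qed.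

Lemma holds_set (T : tapes) S (U : tapes) (i : nat) w : i < m.+3 -> holds T S ->
  stack_tape (U (inord i)) w ->
  (forall j : 'I_m.+3, val j != i -> stack_tape (U j) (stack S j)) ->
  holds U (set_nth [::] S i w).
Proof.
move=> hi [hs hT] hU hj; split; first by rewrite size_set_nth_lt ?hs.
move=> j; rewrite /stack nth_set_nth /=; case: eqP => [e|/eqP]; last exact: hj.
by rewrite -(inord_val j) e.
Qed.

Lemma steps_pop_case c a i l0 l1 le T S : i < m.+3 ->
  a < size c -> nth (jump 0) c a = pop_case i l0 l1 le -> holds T S ->
  if stack S i is b :: w
  then exists2 U, steps c a T (if b then l1 else l0) U &
         holds U (set_nth [::] S i w)
  else exists2 U, steps c a T le U & holds U S.
Proof.
move=> hi ha hf hT; have := step_instr T ha hf; rewrite /= /pop_case ffunE.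
have [hs hTi] := hT; rewrite (tape_read_stack (hTi (inord i))). rewrite (inordK hi).
case E: (stack S i) => [|b w] /= h.
  eexists; first exact: h.
  set U := finfun _; suff -> : U = [ffun i => tape_act (tape_read (T i), None) (T i)].
    exact: holds_stay.
  by apply/ffunP => j; rewrite !ffunE.
eexists; first exact: h.
apply: (holds_set hi hT) => [|j hj].
- rewrite !ffunE /= inordK // eqxx; apply: (@stack_tape_pop _ b).
  by have := hTi (inord i); rewrite inordK // E.
- by rewrite !ffunE (negPf hj); apply: stack_tape_stay.
Qed.

Lemma steps_push c a i b T S : i < m.+3 ->
  code_at c a [:: move_left i a.+1; write i b a.+2] -> holds T S ->
  exists2 U, steps c a T a.+2 U & holds U (set_nth [::] S i (b :: stack S i)).
Proof.
move=> hi /code_at_cons[ha hf /code_at_cons[ha' hf' _]] hT.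
have h1 := step_instr T ha hf; have h2 := step_instr _ ha' hf'.
eexists; first by apply: (steps_trans h1); exact: h2.
have [hs hTi] := hT; apply: (holds_set hi hT) => [|j hj].
- rewrite !ffunE /= inordK // eqxx; apply: stack_tape_push.
  by have := hTi (inord i); rewrite inordK.
- by rewrite !ffunE (negPf hj); do 2!apply: stack_tape_stay.
Qed.

Lemma compile_correct c p a T S : wf m.+3 p -> code_at c a (compile p a) ->
  holds T S -> exists2 U, steps c a T (a + code_size p) U & holds U (exec p S).
Proof.
elim: p a T S => [|i b|p IHp q IHq|i p0 IH0 p1 IH1 pe IHe|i p0 IH0 p1 IH1] a T S /=.
- by move=> _ _ hT; exists T; rewrite ?addn0 //; apply: steps_refl.
- by move=> hi hc hT; rewrite addn2; apply: steps_push.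
- move=> /andP[hp hq] /code_at_cat[h1]; rewrite size_compile => h2 hT.
  have [U hU hU'] := IHp _ _ _ hp h1 hT; have [V hV hV'] := IHq _ _ _ hq h2 hU'.
  by exists V => //; rewrite addnA; apply: (steps_trans hU).
- move=> /and4P[hi w0 w1 we] /code_at_cons[ha hf /code_at_cat[h0]].
  rewrite size_compile => /code_at_cons[ha0 hf0 /code_at_cat[h1]].
  rewrite size_compile => /code_at_cons[ha1 hf1 he] hT.
  have -> : a + (code_size p0 + (code_size p1 + code_size pe).+1).+2 =
    (((a.+1 + code_size p0).+1 + code_size p1).+1 + code_size pe) by lia.
  have := steps_pop_case hi ha hf hT; case: (stack S i) => [|[] w] [U hU hU'].
  + have [V hV hV'] := IHe _ _ _ we he hU'.
    by exists V => //; apply: (steps_trans hU).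
  + have [V hV hV'] := IH1 _ _ _ w1 h1 hU'.
    have [W hW hW'] := steps_jump ha1 hf1 hV'.
    by exists W => //; apply: (steps_trans hU); apply: (steps_trans hV).
  + have [V hV hV'] := IH0 _ _ _ w0 h0 hU'.
    have [W hW hW'] := steps_jump ha0 hf0 hV'.
    by exists W => //; apply: (steps_trans hU); apply: (steps_trans hV).
- move=> /and5P[hi w0 w1 v0 v1] /code_at_cons[ha hf /code_at_cat[h0]].
  rewrite size_compile => /code_at_cons[ha0 hf0 /code_at_cat[h1]].
  rewrite size_compile => /code_at_cons[ha1 hf1 _] hT.
  have -> : a + (code_size p0 + (code_size p1).+1).+2 =
    ((a.+1 + code_size p0).+1 + code_size p1).+1 by lia.
  (* Inner induction on the contents of stack [i]: one pass of the machine pops one bit, and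
     [exec_avoids] moves the remaining bits past the loop body. *)
  have := erefl (stack S i); move: {1 3}(stack S i) => w.
  elim: w S T hT => [|b w IH] S T hT E.
    have := steps_pop_case hi ha hf hT; rewrite -E => -[U hU hU'].
    exists U => //=; suff -> : set_nth [::] S i [::] = S by [].
    have [hs _] := hT; apply: (@eq_from_nth _ [::]).
      by rewrite size_set_nth_lt ?hs.
    by move=> j _; rewrite nth_set_nth /=; case: eqP => // ->; exact: E.
  have := steps_pop_case hi ha hf hT; rewrite -E => -[U hU hU'].
  have stackE R : size R = m.+3 -> stack (set_nth [::] R i w) i = w.
    by rewrite /stack nth_set_nth /= eqxx.
  case: b E hU => /= E hU.
  + have [V hV hV'] := IH1 _ _ _ w1 h1 hU'.
    have [W hW hW'] := steps_jump ha1 hf1 hV'.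
    have [|X hX hX'] := IH _ _ hW'.
      by rewrite exec_avoids // stackE // (size_exec w1) //; case: hT.
    exists X; last by rewrite !exec_avoids // !set_set_nth_same in hX' *.
    by apply: (steps_trans hU); apply: (steps_trans hV); apply: (steps_trans hW).
  + have [V hV hV'] := IH0 _ _ _ w0 h0 hU'.
    have [W hW hW'] := steps_jump ha0 hf0 hV'.
    have [|X hX hX'] := IH _ _ hW'.
      by rewrite exec_avoids // stackE // (size_exec w0) //; case: hT.
    exists X; last by rewrite !exec_avoids // !set_set_nth_same in hX' *.
    by apply: (steps_trans hU); apply: (steps_trans hV); apply: (steps_trans hW).
Qed.

Definition prog_TM (p : prog) : TM := code_TM (compile p 0).

(** Stacks 0, 1 and 2 are the program, condition and output tapes of the machine model. *)
Definition run (p : prog) (e z : bitseq) : bitseq :=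
  stack (exec p [:: e, z & nseq m.+1 [::]]) 2.

Lemma prog_TM_computes p e z : wf m.+3 p -> TM_computes (prog_TM p) e z (run p e z).
Proof.
move=> hp; set T := [ffun i : 'I_m.+3 => tape_of_bits (nth [::] [:: e; z] i)].
have hT : holds T [:: e, z & nseq m.+1 [::]].
  split=> [|i]; first by rewrite /= size_nseq.
  rewrite ffunE; have -> : nth [::] [:: e; z] i = stack [:: e, z & nseq m.+1 [::]] i.
    case: i => -[|[|i]] // lti; rewrite -[LHS]/(nth [::] [::] i) nth_nil.
    by rewrite -[RHS]/(nth [::] (nseq m.+1 [::]) i) nth_nseq if_same.
  exact: stack_tape_of_bits.
have hc : code_at (compile p 0) 0 (compile p 0) by exists [::], [::]; rewrite cats0.
have [U [t ht] [hs hU]] := compile_correct hp hc hT.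
exists t, (inord (0 + code_size p), U); split.
- rewrite -ht; congr (iter t _ (Some (_, _))).
  by apply/val_inj; rewrite /= inordK.
- have sz : code_size p < (size (compile p 0)).+1 by rewrite size_compile.
  rewrite /TM_step /= ffunE /= inordK // add0n ifF //.
  by rewrite size_compile ltnn.
- rewrite /TM_output /=; have [a [b ->]] := hU (inord 2).
  by rewrite inordK //= leading_bits_map.
Qed.

End Compile.

(** * The programs of Alice and Bob *)

(* Alice sends pairs of bits: (true, b) appends the bit [b] to the current address,
   (false, true) asks for the bit of [y] at that address, which Bob sends in the
   phase [Reply], and (false, false) ends the conversation. *)
Inductive phase : Type := Tag | Bit | Cmd | Reply | Done.

(** [asked] counts the bits sent by Alice, hence it is the position in x of her next bit; [pos] is
    the address under construction; [replies] has the latest answer first. *)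
Record scan_state : Type := ScanState {
  ph : phase;
  asked : nat;
  pos : nat;
  replies : bitseq }.

Definition scan_step (s : scan_state) (b : bool) : scan_state :=
  match ph s with
  | Tag => ScanState (if b then Bit else Cmd) (asked s).+1 (pos s) (replies s)
  | Bit => ScanState Tag (asked s).+1 (2 * pos s + b) (replies s)
  | Cmd => ScanState (if b then Reply else Done) (asked s).+1 (pos s) (replies s)
  | Reply => ScanState Tag (asked s) 0 (b :: replies s)
  | Done => s
  end.

Definition scan (w : bitseq) : scan_state :=
  foldl scan_step (ScanState Tag 0 0 [::]) w.

(* These codes are kept on stack 3; [parse] leaves the code of [Tag] there, the
   party's input on stack 1 and the conversation on stack 4. *)
Definition phase_code (p : phase) : bitseq :=
  match p with
  | Tag => [:: true]
  | Bit => [:: false]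
  | Cmd => [:: false; false]
  | Reply => [:: false; true]
  | Done => [::]
  end.

Definition discard (i : nat) : prog := Case i Skip Skip Skip.

(** Stack 3 records whether the separator of [bit_pair] has been read. Before it, ones are counted
    on stack 4. After it, each counted one is traded for a bit of the conversation, put on stack 5;
    the bits left over are the input and go to stack 6. *)
Definition parse_bit (b : bool) : prog :=
  Case 3 Skip (Push 3 true ;; Case 4 Skip (Push 5 b) (Push 6 b))
    (if b then Push 4 true else Push 3 true).

(** The second loop also leaves the length of the input, in unary, on stack 7. *)
Definition parse : prog :=
  Drain 1 (parse_bit false) (parse_bit true) ;;
  Drain 6 (Push 1 false ;; Push 7 true) (Push 1 true ;; Push 7 true) ;;
  Drain 5 (Push 4 false) (Push 4 true).

(** Common skeleton of both parties: it follows [scan_step] on the phase code, with [ask] run on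
    every bit sent by Alice, [bit] on address bits and [reply] on Bob's answers. *)
Definition scan_bit (ask : prog) (bit reply : bool -> prog) (b : bool) : prog :=
  Case 3
    (Case 3 (ask ;; if b then Push 3 true ;; Push 3 false else Skip)
            (reply b ;; Push 3 true)
            (ask ;; bit b ;; Push 3 true))
    (ask ;; if b then Push 3 false else Push 3 false ;; Push 3 false)
    Skip.

(** An exhausted input yields the bit 0, in agreement with the default value of [nth] in
    [instruction_A] and [instruction_B]. *)
Definition send_top : prog :=
  Case 1 (Push 2 false ;; Push 2 false) (Push 2 true ;; Push 2 false)
    (Push 2 false ;; Push 2 false).

Definition alice_scan : bool -> prog :=
  scan_bit (discard 1) (fun=> Skip) (fun b => Push 5 b).

(* During the lookup stack 5 holds the unread part of the answer vector and stack 6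
   the part already compared; stack 4 is nonempty once a mismatch is found, stack 3
   when a payload bit is due.  The payload goes to stack 8, and stack 7 counts the
   zeros of the padding. *)
Definition key_bit (c b : bool) : prog :=
  Push 6 c ;; if c == b then Skip else Push 4 true.

Definition entry_tag (b : bool) : prog :=
  if b then Push 3 true
  else Drain 4 Skip Skip ;; Drain 6 (Push 5 false) (Push 5 true).

Definition lookup_bit (b : bool) : prog :=
  Case 3 Skip (Case 4 (Push 4 false) (Push 4 true) (Push 8 b ;; discard 7))
    (Case 5 (key_bit false b) (key_bit true b) (entry_tag b)).

Definition lookup : prog :=
  Drain 1 (lookup_bit false) (lookup_bit true).

Definition emit : prog :=
  Drain 7 Skip (Push 2 false) ;;
  Drain 8 (Push 2 false) (Push 2 true) ;; Push 2 true.

Definition alice : prog :=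
  parse ;; Drain 4 (alice_scan false) (alice_scan true) ;;
  Case 3 (Case 3 send_top Skip send_top) send_top (lookup ;; emit).

(** The address is kept in unary on stack 6; stack 5 is scratch space. *)
Definition double_add (b : bool) : prog :=
  Drain 6 Skip (Push 5 true ;; Push 5 true) ;; Drain 5 Skip (Push 6 true) ;;
  if b then Push 6 true else Skip.

Definition bob_scan : bool -> prog :=
  scan_bit Skip double_add (fun=> Drain 6 Skip Skip).

Definition bob : prog :=
  parse ;; Drain 4 (bob_scan false) (bob_scan true) ;;
  Case 3 (Case 3 Skip (Drain 6 Skip (discard 1) ;; send_top) Skip) Skip
    (Push 2 true).

(** Ignores its inputs. Applied to the pair of protocol programs, it bounds the complexity of the
    protocol by a constant. *)
Fixpoint push_all (u : bitseq) : prog :=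
  if u is b :: u' then push_all u' ;; Push 2 b else Skip.

(** * Correctness of the stack programs *)

Lemma wf_push_all u : wf 9 (push_all u).
Proof. by elim: u => //= b u ->. Qed.

Lemma run_push_all u e z : run 6 (push_all u) e z = u.
Proof.
rewrite /run; suff -> : exec (push_all u) [:: e, z & nseq 7 [::]] =
  [:: e, z, u & nseq 6 [::]] by [].
by elim: u => //= b u ->.
Qed.

Lemma exec_seq p q S : exec (p ;; q) S = exec q (exec p S).
Proof. by []. Qed.

Lemma exec_drain i p0 p1 S : exec (Drain i p0 p1) S =
  foldl (fun S b => if b then exec p1 S else exec p0 S)
    (set_nth [::] S i [::]) (stack S i).
Proof. by rewrite /=; elim: (stack S i) (set_nth _ _ _ _) => //= -[] w IH T. Qed.

Lemma foldl_exec f w S :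
  foldl (fun S b => if b then exec (f true) S else exec (f false) S) S w =
  foldl (fun S b => exec (f b) S) S w.
Proof. by elim: w S => //= -[] w IH S. Qed.

Lemma exec_parse w v :
  exec parse [:: [::], bit_pair w v & nseq 7 [::]] =
  [:: [::]; v; [::]; [:: true]; w; [::]; [::]; nseq (size v) true; [::]].
Proof.
pose S2 a c d e := [:: [::]; a; [::]; c; d; e; [::]; [::]; [::] : bitseq].
pose S3 c d e f := [:: [::]; [::]; [::]; c; d; e; f; [::]; [::] : bitseq].
(* [count], [word] and [rest] treat the parts 1^|w|, w and v of the pair in the first loop; [back]
   and [back'] treat the loops that undo the reversals. *)
have count n j : foldl (fun S b => exec (parse_bit b) S)
    (S3 [::] (nseq j true) [::] [::]) (nseq n true) =
    S3 [::] (nseq (n + j) true) [::] [::].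
  elim: n j => //= n IH j; rewrite -[true :: nseq j true]/(nseq j.+1 true).
  by rewrite -/(S3 _ _ _ _) IH addnS.
have word u e : foldl (fun S b => exec (parse_bit b) S)
    (S3 [:: true] (nseq (size u) true) e [::]) u =
    S3 [:: true] [::] (catrev u e) [::].
  by elim: u e => //= b u IH e; rewrite -/(S3 _ _ _ _) IH.
have rest u e f : foldl (fun S b => exec (parse_bit b) S)
    (S3 [:: true] [::] e f) u = S3 [:: true] [::] e (catrev u f).
  by elim: u f => //= b u IH f; rewrite -/(S3 _ _ _ _) IH.
have back u v' l d e : foldl (fun S b => exec (Push 1 b ;; Push 7 true) S)
    [:: [::]; v'; [::]; [:: true]; d; e; [::]; nseq l true; [::]] u =
    [:: [::]; catrev u v'; [::]; [:: true]; d; e; [::]; nseq (size u + l) true; [::]].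
  elim: u v' l => //= b u IH v' l; rewrite -[true :: nseq l true]/(nseq l.+1 true).
  by rewrite IH addnS.
have back' u v' l d : foldl (fun S b => exec (Push 4 b) S)
    [:: [::]; v'; [::]; [:: true]; d; [::]; [::]; l; [::]] u =
    [:: [::]; v'; [::]; [:: true]; catrev u d; [::]; [::]; l; [::]].
  by elim: u d => //= b u IH d; rewrite IH.
have -> : exec parse [:: [::], bit_pair w v & nseq 7 [::]] =
  exec (Drain 5 (Push 4 false) (Push 4 true))
    (exec (Drain 6 (Push 1 false ;; Push 7 true) (Push 1 true ;; Push 7 true))
      (exec (Drain 1 (parse_bit false) (parse_bit true))
        [:: [::]; bit_pair w v; [::]; [::]; [::]; [::]; [::]; [::]; [::]])) by [].
have -> : exec (Drain 1 (parse_bit false) (parse_bit true))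
    [:: [::]; bit_pair w v; [::]; [::]; [::]; [::]; [::]; [::]; [::]] =
    S3 [:: true] [::] (rev w) (rev v).
  rewrite exec_drain foldl_exec -[X in foldl _ X]/(S3 [::] (nseq 0 true) [::] [::]).
  rewrite -[X in foldl _ _ X]/(nseq (size w) true ++ [:: false] ++ w ++ v).
  rewrite !foldl_cat count addn0.
  rewrite -[X in foldl _ (foldl _ X _) _]/(S3 [:: true] (nseq (size w) true) [::] [::]).
  by rewrite word rest.
have -> : exec (Drain 6 (Push 1 false ;; Push 7 true) (Push 1 true ;; Push 7 true))
    (S3 [:: true] [::] (rev w) (rev v)) =
    [:: [::]; v; [::]; [:: true]; [::]; rev w; [::]; nseq (size v) true; [::]].
  rewrite exec_drain (foldl_exec (fun b => Push 1 b ;; Push 7 true)).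
  rewrite -[X in foldl _ X]/
    [:: [::]; [::]; [::]; [:: true]; [::]; rev w; [::]; nseq 0 true; [::]].
  by rewrite -[X in foldl _ _ X]/(rev v) back addn0 -/(rev (rev v)) revK size_rev.
rewrite exec_drain (foldl_exec (fun b => Push 4 b)).
rewrite -[X in foldl _ X]/
  [:: [::]; v; [::]; [:: true]; [::]; [::]; [::]; nseq (size v) true; [::]].
by rewrite -[X in foldl _ _ X]/(rev w) back' -/(rev (rev w)) revK.
Qed.

(** Loop invariant of Alice's scan; [bob_stacks] is the one for Bob. *)
Definition alice_stacks (x l : bitseq) (s : scan_state) : stacks :=
  [:: [::]; drop (asked s) x; [::]; phase_code (ph s); [::]; replies s; [::]; l; [::]].

Definition bob_stacks (y l : bitseq) (s : scan_state) : stacks :=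
  [:: [::]; y; [::]; phase_code (ph s); [::]; [::]; nseq (pos s) true; l; [::]].

Lemma exec_alice_scan x l s b :
  exec (alice_scan b) (alice_stacks x l s) = alice_stacks x l (scan_step s b).
Proof.
case: s => q a p r; rewrite /alice_stacks.
have E : drop a.+1 x = behead (drop a x) by rewrite -drop1 drop_drop.
by case: q; rewrite /scan_step [asked _]/= ?E; case: (drop a x) => [|[] t]; case: b.
Qed.

Lemma exec_double_add b p q y c l :
  exec (double_add b) [:: [::]; y; c; q; [::]; [::]; nseq p true; l; [::]] =
  [:: [::]; y; c; q; [::]; [::]; nseq (2 * p + b) true; l; [::]].
Proof.
have double n j : foldl (fun S b => if b then exec (Push 5 true ;; Push 5 true) S else S)
    [:: [::]; y; c; q; [::]; nseq j true; [::]; l; [::]] (nseq n true) =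
    [:: [::]; y; c; q; [::]; nseq (2 * n + j) true; [::]; l; [::]].
  elim: n j => //= n IH j; rewrite -[[:: true, true & _]]/(nseq j.+2 true) IH.
  by have -> : 2 * n + j.+2 = 2 * n.+1 + j by lia.
have back n j : foldl (fun S b => if b then exec (Push 6 true) S else S)
    [:: [::]; y; c; q; [::]; [::]; nseq j true; l; [::]] (nseq n true) =
    [:: [::]; y; c; q; [::]; [::]; nseq (n + j) true; l; [::]].
  elim: n j => //= n IH j; rewrite -[true :: _]/(nseq j.+1 true) IH.
  by rewrite addnS.
rewrite /double_add !exec_seq.
have -> : exec (Drain 6 Skip (Push 5 true ;; Push 5 true))
    [:: [::]; y; c; q; [::]; [::]; nseq p true; l; [::]] =
    [:: [::]; y; c; q; [::]; nseq (2 * p) true; [::]; l; [::]].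
  by rewrite exec_drain (double p 0) addn0.
have -> : exec (Drain 5 Skip (Push 6 true))
    [:: [::]; y; c; q; [::]; nseq (2 * p) true; [::]; l; [::]] =
    [:: [::]; y; c; q; [::]; [::]; nseq (2 * p) true; l; [::]].
  by rewrite exec_drain (back (2 * p) 0) addn0.
by case: b; rewrite ?addn0 ?addn1.
Qed.

Lemma exec_bob_scan y l s b :
  exec (bob_scan b) (bob_stacks y l s) = bob_stacks y l (scan_step s b).
Proof.
case: s => q a p r; rewrite /bob_stacks; case: q; first by case: b.
- have -> : exec (bob_scan b)
      [:: [::]; y; [::]; [:: false]; [::]; [::]; nseq p true; l; [::]] =
      exec (Push 3 true) (exec (double_add b)
        [:: [::]; y; [::]; [::]; [::]; [::]; nseq p true; l; [::]]) by [].
  by rewrite exec_double_add.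
- by case: b.
- by rewrite /= /stack /=; elim: p => //=.
- by [].
Qed.

Lemma exec_scan_loop (f : bool -> prog) (stacks_of : scan_state -> stacks) s w :
  (forall s b, exec (f b) (stacks_of s) = stacks_of (scan_step s b)) ->
  foldl (fun S b => if b then exec (f true) S else exec (f false) S) (stacks_of s) w =
  stacks_of (foldl scan_step s w).
Proof. by rewrite foldl_exec => h; elim: w s => //= b w IH s; rewrite h IH. Qed.

Lemma run_alice w x : run 6 alice [::] (bit_pair w x) =
  stack (exec
    (Case 3 (Case 3 send_top Skip send_top) send_top (lookup ;; emit))
    (alice_stacks x (nseq (size x) true) (scan w))) 2.
Proof.
rewrite /run /alice 2!exec_seq exec_parse exec_drain.
set l := nseq (size x) true.
have -> : set_nth [::] [:: [::]; x; [::]; [:: true]; w; [::]; [::]; l; [::]] 4 [::] =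
  alice_stacks x l (ScanState Tag 0 0 [::]) by rewrite /alice_stacks drop0.
by rewrite (exec_scan_loop (f := alice_scan) _ _ (@exec_alice_scan x l)).
Qed.

Lemma run_bob w y : run 6 bob [::] (bit_pair w y) =
  stack (exec
    (Case 3 (Case 3 Skip (Drain 6 Skip (discard 1) ;; send_top) Skip) Skip
      (Push 2 true))
    (bob_stacks y (nseq (size y) true) (scan w))) 2.
Proof.
rewrite /run /bob 2!exec_seq exec_parse exec_drain.
set l := nseq (size y) true.
have -> : set_nth [::] [:: [::]; y; [::]; [:: true]; w; [::]; [::]; l; [::]] 4 [::] =
  bob_stacks y l (ScanState Tag 0 0 [::]) by [].
by rewrite (exec_scan_loop (f := bob_scan) _ _ (@exec_bob_scan y l)).
Qed.

Lemma exec_send_top S : size S = 9 -> stack S 2 = [::] ->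
  stack (exec send_top S) 2 = [:: false; head false (stack S 1)].
Proof.
case: S => [|? [|u [|? [|? S]]]] // _; rewrite /stack /= => ->.
by case: u => [|[] u].
Qed.

Lemma head_drop (T : Type) (x0 : T) n s : head x0 (drop n s) = nth x0 s n.
Proof. by rewrite -nth0 nth_drop addn0. Qed.

Lemma run_bobE w y : run 6 bob [::] (bit_pair w y) =
  match ph (scan w) with
  | Reply => [:: false; nth false y (pos (scan w))]
  | Done => [:: true]
  | _ => [::]
  end.
Proof.
rewrite run_bob; case: (scan w) => -[] a p r //.
set l := nseq _ _.
have skip n v : exec (Drain 6 Skip (discard 1))
    [:: [::]; v; [::]; [::]; [::]; [::]; nseq n true; l; [::]] =
    [:: [::]; drop n v; [::]; [::]; [::]; [::]; [::]; l; [::]].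
  rewrite exec_drain.
  have -> : stack [:: [::]; v; [::]; [::]; [::]; [::]; nseq n true; l; [::]] 6 =
    nseq n true by [].
  have -> : set_nth [::] [:: [::]; v; [::]; [::]; [::]; [::]; nseq n true; l; [::]] 6 [::] =
    [:: [::]; v; [::]; [::]; [::]; [::]; [::]; l; [::]] by [].
  by elim: n v => [|n IH] [|b v] //=; case: b; rewrite IH.
have -> : exec (Case 3 (Case 3 Skip (Drain 6 Skip (discard 1) ;; send_top) Skip) Skip
      (Push 2 true)) (bob_stacks y l (ScanState Reply a p r)) =
  exec send_top (exec (Drain 6 Skip (discard 1))
    [:: [::]; y; [::]; [::]; [::]; [::]; nseq p true; l; [::]]) by [].
by rewrite skip exec_send_top // -head_drop.
Qed.

(** * Lookup in the table of x *)

Definition lookup_stacks (f r r' l o : bitseq) : stacks :=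
  [:: [::]; [::]; [::]; [::]; f; r; r'; l; o].

(** Self-delimiting code: a 1 announces each bit and a 0 closes, so zeros after the table never
    announce a payload bit. *)
Definition payload (z : bitseq) : bitseq :=
  flatten [seq [:: true; b] | b <- z] ++ [:: false].

Definition entry (e : bitseq * bitseq) : bitseq := e.1 ++ payload e.2.

Definition run_lookup (S : stacks) (u : bitseq) : stacks :=
  foldl (fun S b => exec (lookup_bit b) S) S u.

Arguments run_lookup S u : simpl never.

Lemma run_lookup_cons S b u :
  run_lookup S (b :: u) = run_lookup (exec (lookup_bit b) S) u.
Proof. by []. Qed.

Lemma run_lookup_cat S u v : run_lookup S (u ++ v) = run_lookup (run_lookup S u) v.
Proof. exact: foldl_cat. Qed.

Lemma run_lookup_key f r r' l o key : size key = size r ->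
  exists2 f', run_lookup (lookup_stacks f r r' l o) key =
              lookup_stacks f' [::] (catrev r r') l o
            & nilp f' = nilp f && (key == r).
Proof.
elim: key f r r' => [|b key IH] f [|c r] r' //= => [_|[hs]].
  by exists f; rewrite ?andbT.
rewrite run_lookup_cons.
have -> : exec (lookup_bit b) (lookup_stacks f (c :: r) r' l o) =
  lookup_stacks (if c == b then f else true :: f) r (c :: r') l o.
  by case: b; case: c.
have [f' -> Ef] := IH (if c == b then f else true :: f) r (c :: r') hs.
exists f' => //; rewrite Ef eqseq_cons eq_sym.
by case: eqP => //= _; rewrite andbF.
Qed.

(** The closing 0 erases the mismatch marks and moves the compared answer vector back to stack 5, so
    every entry starts from the same configuration. *)
Lemma run_lookup_payload f r' l o z :
  run_lookup (lookup_stacks f [::] r' l o) (payload z) =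
  if nilp f then lookup_stacks [::] (rev r') [::] (drop (size z) l) (catrev z o)
  else lookup_stacks [::] (rev r') [::] l o.
Proof.
have close f' v r l' o' : exec (entry_tag false) (lookup_stacks f' r v l' o') =
    lookup_stacks [::] (catrev v r) [::] l' o'.
  have -> : exec (entry_tag false) (lookup_stacks f' r v l' o') =
      exec (Drain 6 (Push 5 false) (Push 5 true))
        (exec (Drain 4 Skip Skip) (lookup_stacks f' r v l' o')) by [].
  have -> : exec (Drain 4 Skip Skip) (lookup_stacks f' r v l' o') =
      lookup_stacks [::] r v l' o'.
    by rewrite exec_drain; elim: f' => //= -[].
  rewrite exec_drain (foldl_exec (fun b => Push 5 b)).
  have -> : set_nth [::] (lookup_stacks [::] r v l' o') 6 [::] =
      lookup_stacks [::] r [::] l' o' by [].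
  have -> : stack (lookup_stacks [::] r v l' o') 6 = v by [].
  by elim: v r => //= b v IH r; rewrite -[RHS]IH.
rewrite /payload; elim: z l o => [|b z IH] l o.
  rewrite /= drop0 if_same.
  exact: (close f r' [::] l o).
rewrite -[flatten _ ++ _]/[:: true, b & flatten [seq [:: true; b] | b <- z] ++ [:: false]].
rewrite 2!run_lookup_cons.
have -> : exec (lookup_bit b) (exec (lookup_bit true) (lookup_stacks f [::] r' l o)) =
  if nilp f then lookup_stacks f [::] r' (behead l) (b :: o) else lookup_stacks f [::] r' l o.
  by case: f {IH} => [|[] f] //; case: b => //; case: l => [|[] l].
case: (nilp f) IH => IH; rewrite IH //=.
by congr lookup_stacks; rewrite -drop1 drop_drop addn1.
Qed.

Lemma run_lookup_entry r l o e : size e.1 = size r ->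
  run_lookup (lookup_stacks [::] r [::] l o) (entry e) =
  if e.1 == r then lookup_stacks [::] r [::] (drop (size e.2) l) (catrev e.2 o)
  else lookup_stacks [::] r [::] l o.
Proof.
move=> hs; rewrite run_lookup_cat.
have [f' -> hf'] := run_lookup_key [::] [::] l o hs.
by rewrite run_lookup_payload hf' /= -/(rev _) -/(rev r) revK.
Qed.

(** The zeros that fill up x are read as key bits and as ends of empty payloads; even a matching key
    then copies nothing. *)
Lemma run_lookup_zeros f r r' l o n : exists f' s s',
  run_lookup (lookup_stacks f r r' l o) (nseq n false) = lookup_stacks f' s s' l o.
Proof.
elim: n f r r' => [|n IH] f r r'; first by exists f, r, r'.
rewrite run_lookup_cons; case: r => [|c r].
  have := run_lookup_payload f r' l o [::]; rewrite drop0 if_same.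
  by rewrite -[LHS]/(exec (lookup_bit false) _) => ->; apply: IH.
have -> : exec (lookup_bit false) (lookup_stacks f (c :: r) r' l o) =
  lookup_stacks (if c then true :: f else f) r (c :: r') l o by case: c.
exact: IH.
Qed.

(** The keys are distinct, so only the entry of [r] is copied; [idle] handles the entries that
    follow it. *)
Lemma run_lookup_table es r l z : uniq [seq e.1 | e <- es] ->
  (forall e, e \in es -> size e.1 = size r) -> (r, z) \in es ->
  run_lookup (lookup_stacks [::] r [::] l [::]) (flatten (map entry es)) =
  lookup_stacks [::] r [::] (drop (size z) l) (rev z).
Proof.
have idle es' l' o : r \notin [seq e.1 | e <- es'] ->
    (forall e, e \in es' -> size e.1 = size r) ->
    run_lookup (lookup_stacks [::] r [::] l' o) (flatten (map entry es')) =
    lookup_stacks [::] r [::] l' o.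
  elim: es' => //= e es' IH; rewrite inE negb_or => /andP[hr hrs] hs.
  rewrite run_lookup_cat run_lookup_entry ?hs ?mem_head // eq_sym (negPf hr).
  by apply: IH => // e' he'; apply: hs; rewrite inE he' orbT.
elim: es => //= e es IH /andP[he hes] hs; rewrite inE run_lookup_cat.
rewrite run_lookup_entry ?hs ?mem_head //.
have hs' e' : e' \in es -> size e'.1 = size r.
  by move=> he'; apply: hs; rewrite inE he' orbT.
case: (e.1 =P r) => [er|ner].
  have hr : r \notin [seq e'.1 | e' <- es] by rewrite -er.
  rewrite (idle _ _ _ hr hs') => /orP[/eqP <- //|hz].
  by case/negP: hr; apply/mapP; exists (r, z).
case/orP => [/eqP ez|]; last exact: IH.
by rewrite -ez in ner.
Qed.

Lemma exec_emit f r r' n o :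
  stack (exec emit (lookup_stacks f r r' (nseq n true) o)) 2 =
  true :: catrev o (nseq n false).
Proof.
pose S u l o := [:: [::]; [::]; u; [::]; f; r; r'; l; o : bitseq].
have zeros k j : foldl (fun S b => if b then exec (Push 2 false) S else S)
    (S (nseq j false) [::] o) (nseq k true) = S (nseq (k + j) false) [::] o.
  elim: k j => //= k IH j; rewrite -[false :: _]/(nseq j.+1 false).
  by rewrite -/(S _ _ _) IH addnS.
have word v u : foldl (fun S b => exec (Push 2 b) S) (S u [::] [::]) v =
    S (catrev v u) [::] [::].
  by elim: v u => //= b v IH u; rewrite -/(S _ _ _) IH.
rewrite /emit 2!exec_seq.
have -> : exec (Drain 7 Skip (Push 2 false)) (lookup_stacks f r r' (nseq n true) o) =
    S (nseq n false) [::] o.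
  by rewrite exec_drain -[n in RHS]addn0 -zeros.
by rewrite exec_drain (foldl_exec (fun b => Push 2 b)) [foldl _ _ _]word.
Qed.

(** Stack 7 starts with the length of x and loses one element per payload bit, which leaves the
    number of zeros needed to extend [z] to that length. *)
Lemma run_alice_halt w x es z n : ph (scan w) = Done ->
  drop (asked (scan w)) x = flatten (map entry es) ++ nseq n false ->
  uniq [seq e.1 | e <- es] ->
  (forall e, e \in es -> size e.1 = size (replies (scan w))) ->
  (replies (scan w), z) \in es ->
  run 6 alice [::] (bit_pair w x) = true :: z ++ nseq (size x - size z) false.
Proof.
rewrite run_alice; case: (scan w) => q a p r.
rewrite [ph _]/= [asked _]/= [replies _]/= => -> hx hu hs hz.
set l := nseq _ _.
rewrite -[X in stack X _]/(exec emit (exec lookup (alice_stacks x l (ScanState Done a p r)))).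
rewrite exec_drain (foldl_exec lookup_bit).
rewrite -[stack (alice_stacks _ _ _) 1]/(drop a x) hx.
rewrite -[foldl _ _ _]/(run_lookup (lookup_stacks [::] r [::] l [::]) _).
rewrite run_lookup_cat (run_lookup_table _ hu hs hz).
have [f' [s [s' ->]]] := run_lookup_zeros [::] r [::] (drop (size z) l) (rev z) n.
by rewrite /l drop_nseq exec_emit catrevE revK.
Qed.

Lemma run_aliceE w x :
  match ph (scan w) with
  | Reply => run 6 alice [::] (bit_pair w x) = [::]
  | Done => exists z, run 6 alice [::] (bit_pair w x) = true :: z
  | _ => run 6 alice [::] (bit_pair w x) =
         [:: false; nth false x (asked (scan w))]
  end.
Proof.
rewrite run_alice; case: (scan w) => -[] a p r; rewrite [ph _]/=; set l := nseq _ _.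
1-3: rewrite -[X in stack X _]/(exec send_top
  [:: [::]; drop a x; [::]; [::]; [::]; r; [::]; l; [::]]).
1-3: by rewrite exec_send_top // -head_drop.
- by [].
- have push T : stack (exec (Push 2 true) T) 2 = true :: stack T 2.
    by rewrite [exec _ _]/= {1}/stack nth_set_nth.
  set S := alice_stacks _ _ _.
  rewrite -[X in stack X _]/(exec (Push 2 true)
    (exec (Drain 8 (Push 2 false) (Push 2 true))
      (exec (Drain 7 Skip (Push 2 false)) (exec lookup S)))).
  by rewrite push; eexists.
Qed.

Definition query (bs : bitseq) : bitseq :=
  flatten [seq [:: true; b] | b <- bs] ++ [:: false; true].

Definition address (bs : bitseq) : nat := foldl (fun p (b : bool) => 2 * p + b) 0 bs.

(** * Determinism of the universal machine and instructions of the protocol *)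

Lemma univ_computes M p z u : TM_computes M p z u ->
  univ (nseq (pickle M).+1 true ++ false :: p) z u.
Proof. by move=> h; exists M, p. Qed.

Lemma nseq_true_inj a b (p q : bitseq) :
  nseq a true ++ false :: p = nseq b true ++ false :: q -> a = b /\ p = q.
Proof. by elim: a b => [|a IH] [|b] //= [] // /IH[-> ->]. Qed.

Lemma bit_pair_inj u v u' v' : bit_pair u v = bit_pair u' v' -> u = u' /\ v = v'.
Proof.
move=> /nseq_true_inj[hs /eqP]; rewrite eqseq_cat // => /andP[/eqP -> /eqP ->].
by [].
Qed.

Lemma TM_computes_inj M p z u u' :
  TM_computes M p z u -> TM_computes M p z u' -> u = u'.
Proof.
have stuck d c c' : TM_step c = None ->
    iter d (obind (@TM_step M)) (Some c) = Some c' -> c = c'.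
  case: d => [_ []//|d] hc; rewrite iterSr /= hc.
  by have -> : iter d (obind (@TM_step M)) None = None by elim: d => //= d ->.
move=> [t [c [ht hc <-]]] [t' [c' [ht' hc' <-]]]; congr TM_output.
wlog le_tt' : t t' c c' ht hc ht' hc' / t <= t'.
  by move=> H; case: (leqP t t') => [|/ltnW] h; [|symmetry]; apply: H h.
move: ht'; rewrite -(subnK le_tt') iterD ht.
exact: stuck.
Qed.

Lemma univ_inj e z u u' : univ e z u -> univ e z u' -> u = u'.
Proof.
move=> [M [p [-> h]]] [M' [p' [/nseq_true_inj[[eM] ep] h']]].
have eM' := pcan_inj (@pickleK _) eM; rewrite -ep -eM' in h'.
exact: TM_computes_inj h h'.
Qed.

Lemma told_inj p w v i j : told p w v i -> told p w v j -> i = j.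
Proof. by move=> [u hu hi] [u' /(univ_inj hu) <-]; rewrite hi => -[]. Qed.

Definition program (p : prog) : bitseq :=
  nseq (pickle (prog_TM 6 p)).+1 true ++ [:: false].

Lemma univ_program p z : wf 9 p -> univ (program p) z (run 6 p [::] z).
Proof. by move=> hp; apply: univ_computes; apply: prog_TM_computes. Qed.

Definition instruction_A (w x : bitseq) : instruction :=
  match ph (scan w) with
  | Reply => Wait
  | Done => Halt (behead (run 6 alice [::] (bit_pair w x)))
  | _ => Send (nth false x (asked (scan w)))
  end.

Definition instruction_B (w y : bitseq) : instruction :=
  match ph (scan w) with
  | Reply => Send (nth false y (pos (scan w)))
  | Done => Halt [::]
  | _ => Wait
  end.

Lemma told_alice w x : told (program alice) w x (instruction_A w x).
Proof.
exists (run 6 alice [::] (bit_pair w x)); first exact: univ_program.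
have := run_aliceE w x; rewrite /instruction_A.
by case: (ph (scan w)) => [-> //|-> //|-> //|-> //|[z ->]].
Qed.

Lemma told_bob w y : told (program bob) w y (instruction_B w y).
Proof.
exists (run 6 bob [::] (bit_pair w y)); first exact: univ_program.
by rewrite run_bobE /instruction_B; case: (ph (scan w)).
Qed.

(** * Runs of the protocol *)

Definition protocol : program_pair := (program alice, program bob).

Definition alice_turn (p : phase) : bool :=
  match p with Reply | Done => false | _ => true end.

Lemma scan_rcons w b : scan (rcons w b) = scan_step (scan w) b.
Proof. by rewrite /scan -cats1 foldl_cat. Qed.

Lemma conversation_ask x y w : conversation protocol x y w ->
  alice_turn (ph (scan w)) ->
  conversation protocol x y (rcons w (nth false x (asked (scan w)))).
Proof.
move=> hw ht; apply: Conv_Alice => //.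
- by have := told_alice w x; rewrite /instruction_A; case: (ph (scan w)) ht.
- by have := told_bob w y; rewrite /instruction_B; case: (ph (scan w)) ht.
Qed.

Lemma conversation_reply x y w : conversation protocol x y w ->
  ph (scan w) = Reply ->
  conversation protocol x y (rcons w (nth false y (pos (scan w)))).
Proof.
move=> hw ht; apply: Conv_Bob => //.
- by have := told_alice w x; rewrite /instruction_A ht.
- by have := told_bob w y; rewrite /instruction_B ht.
Qed.

Lemma partial_protocol_protocol n : partial_protocol n protocol.
Proof.
move=> x y w _; split=> b i hb hi.
- have := told_inj hb (told_alice w x); rewrite (told_inj hi (told_bob w y)).
  by rewrite /instruction_A /instruction_B; case: (ph (scan w)).
- have := told_inj hb (told_bob w y); rewrite (told_inj hi (told_alice w x)).
  by rewrite /instruction_A /instruction_B; case: (ph (scan w)).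
Qed.

(* Beyond the end of [x] Alice sends only zeros, and two zeros end the run. *)
Lemma conversation_ends x y w : conversation protocol x y w ->
  exists2 w', conversation protocol x y w' & ph (scan w') = Done.
Proof.
(* While Alice is still inside x, her bit lowers the first summand by 3, more than the largest rise
   of [rank], which is 2 from [Cmd] to [Reply]. Replies, and the zeros sent beyond x, lower [rank]
   itself. *)
pose rank p := match p with Done => 0 | Cmd => 1 | Tag => 2 | _ => 3 end.
have [t] := ubnP (3 * (size x - asked (scan w)) + rank (ph (scan w))).
elim: t w => // t IH w lt_t hw.
have ask : alice_turn (ph (scan w)) ->
    exists2 w', conversation protocol x y w' & ph (scan w') = Done.
  move=> ht; apply: (IH _ _ (conversation_ask hw ht)); rewrite scan_rcons.
  have [le_x|lt_x] := leqP (size x) (asked (scan w)).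
    rewrite nth_default //; move: ht lt_t le_x.
    by case: (scan w) => -[] a p r //= _; lia.
  move: ht lt_t lt_x; set b := nth _ _ _; move: b => b.
  by case: (scan w) => -[] a p r //= _; case: b => /=; lia.
case E: (ph (scan w)) ask => ask; try exact: ask.
- apply: (IH _ _ (conversation_reply hw E)); rewrite scan_rcons.
  rewrite E in lt_t; move: lt_t E; set b := nth _ _ _; move: b => b.
  by case: (scan w) => q a p r /= lt_t ->; rewrite /=; lia.
- by exists w.
Qed.

Lemma total_protocol_protocol n : total_protocol n protocol.
Proof.
split=> [|x y]; first exact: partial_protocol_protocol.
have [w hw hd] := conversation_ends (Conv_nil protocol x y).
exists w; split=> //; [eexists|exists [::]].
- by have := told_alice w x; rewrite /instruction_A hd; apply.
- by have := told_bob w y; rewrite /instruction_B hd.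
Qed.

Lemma drop_consE (T : Type) (x0 : T) a (x : seq T) b t : drop a x = b :: t ->
  nth x0 x a = b /\ drop a.+1 x = t.
Proof.
move=> h; rewrite -head_drop h /=; split=> //.
by rewrite -add1n -drop_drop h /= drop0.
Qed.

Lemma conversation_send x y w b t : conversation protocol x y w ->
  alice_turn (ph (scan w)) -> drop (asked (scan w)) x = b :: t ->
  conversation protocol x y (rcons w b).
Proof.
by move=> hw ht /(drop_consE false)[<- _]; apply: conversation_ask.
Qed.

(** The 3 counts the pair that asks and Bob's reply. The partial address [p] is arbitrary for the
    induction on [bs]. *)
Lemma conversation_query x y bs w a p r t : conversation protocol x y w ->
  scan w = ScanState Tag a p r -> drop a x = query bs ++ t ->
  exists w' a', [/\ conversation protocol x y w',
    scan w' = ScanState Tag a' 0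
      (nth false y (foldl (fun p (b : bool) => 2 * p + b) p bs) :: r),
    drop a' x = t & size w' = size w + (2 * size bs + 3)].
Proof.
elim: bs w a p => [|b bs IH] w a p hw hs hx.
  have [_ hx1] := drop_consE false hx; have [_ hx2] := drop_consE false hx1.
  have h1 : conversation protocol x y (rcons w false).
    by apply: (conversation_send hw); rewrite hs //; exact: hx.
  have s1 : scan (rcons w false) = ScanState Cmd a.+1 p r.
    by rewrite scan_rcons hs.
  have h2 : conversation protocol x y (rcons (rcons w false) true).
    by apply: (conversation_send h1); rewrite s1 //; exact: hx1.
  have s2 : scan (rcons (rcons w false) true) = ScanState Reply a.+2 p r.
    by rewrite scan_rcons s1.
  have := conversation_reply h2; rewrite s2 => /(_ erefl) h3.
  exists (rcons (rcons (rcons w false) true) (nth false y p)), a.+2.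
  split=> //; first by rewrite scan_rcons s2.
  by rewrite !size_rcons /=; lia.
have [_ hx1] := drop_consE false hx; have [_ hx2] := drop_consE false hx1.
have h1 : conversation protocol x y (rcons w true).
  by apply: (conversation_send hw); rewrite hs //; exact: hx.
have s1 : scan (rcons w true) = ScanState Bit a.+1 p r by rewrite scan_rcons hs.
have h2 : conversation protocol x y (rcons (rcons w true) b).
  by apply: (conversation_send h1); rewrite s1 //; exact: hx1.
have s2 : scan (rcons (rcons w true) b) = ScanState Tag a.+2 (2 * p + b) r.
  by rewrite scan_rcons s1.
have [w' [a' [hw' hs' hx' hsz]]] := IH _ _ _ h2 s2 hx2.
exists w', a'; split=> //; rewrite hsz !size_rcons /=; lia.
Qed.

Lemma conversation_queries x y qs L w a r t :
  (forall bs, bs \in qs -> size bs = L) -> conversation protocol x y w ->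
  scan w = ScanState Tag a 0 r ->
  drop a x = flatten (map query qs) ++ [:: false, false & t] ->
  exists w' a', [/\ conversation protocol x y w',
    scan w' = ScanState Done a' 0
      (catrev [seq nth false y (address bs) | bs <- qs] r),
    drop a' x = t & size w' = size w + (size qs * (2 * L + 3) + 2)].
Proof.
elim: qs w a r => [|bs qs IH] w a r hL hw hs hx.
  have [_ hx1] := drop_consE false hx; have [_ hx2] := drop_consE false hx1.
  have h1 : conversation protocol x y (rcons w false).
    by apply: (conversation_send hw); rewrite hs //; exact: hx.
  have s1 : scan (rcons w false) = ScanState Cmd a.+1 0 r.
    by rewrite scan_rcons hs.
  have h2 : conversation protocol x y (rcons (rcons w false) false).
    by apply: (conversation_send h1); rewrite s1 //; exact: hx1.
  exists (rcons (rcons w false) false), a.+2; split=> //.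
    by rewrite scan_rcons s1.
  by rewrite !size_rcons /=; lia.
rewrite /= -catA in hx.
have [w1 [a1 [hw1 hs1 hx1 hsz1]]] := conversation_query hw hs hx.
have hL' cs : cs \in qs -> size cs = L by move=> h; apply: hL; rewrite inE h orbT.
have [w2 [a2 [hw2 hs2 hx2 hsz2]]] := IH _ _ _ hL' hw1 hs1 hx1.
exists w2, a2; split=> //.
by rewrite hsz2 hsz1 (hL bs) ?mem_head //=; lia.
Qed.

(** * Messages of one-way protocols *)

(** Induction on the list: positions that separate the tail leave at most one string of it that
    agrees with the new [z], and one position where the two differ repairs this. *)
Lemma separating_positions k (zs : seq bitseq) :
  uniq zs -> (forall z, z \in zs -> size z = k) ->
  exists ps : seq nat, [/\ size ps <= (size zs).-1, (forall p, p \in ps -> p < k) &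
    {in zs &, injective (fun z => [seq nth false z p | p <- ps])}].
Proof.
elim: zs => [_ _|z zs IH /= /andP[hz hu] hk]; first by exists [::].
have [|ps [hps hlt hinj]] := IH hu; first by move=> u hu'; apply: hk; rewrite inE hu' orbT.
pose key ps := fun z => [seq nth false z p | p <- ps].
have [/hasP[z' hz' /eqP hkey]|/hasPn hno] := boolP (has (fun u => key ps u == key ps z) zs).
  have [p hp hne] : exists2 p, p < k & nth false z p != nth false z' p.
    apply/exists2P; apply: contrapT => hall.
    move: hz; rewrite (_ : z = z') ?hz' //.
    have [sz sz'] : size z = k /\ size z' = k by rewrite !hk ?inE ?eqxx ?hz' ?orbT.
    apply: (@eq_from_nth _ false) => [|p]; rewrite sz // => hp.
    by apply/eqP/negPn/negP => hne; apply: hall; exists p.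
  have hz'z u : u \in zs -> key ps u = key ps z -> nth false u p = nth false z p -> False.
    move=> hu' hk1; rewrite -hkey in hk1; rewrite (hinj _ _ hu' hz' hk1).
    by move=> h; rewrite h eqxx in hne.
  exists (p :: ps); split=> [|q|u v] /=.
  - by case: (zs) hz' hps => //= _ l _; lia.
  - by rewrite inE => /orP[/eqP ->|/hlt].
  - rewrite !inE => /orP[/eqP ->|hu'] /orP[/eqP ->|hv'] // [h1 h2].
    + by case: (hz'z v).
    + by case: (hz'z u).
    + exact: hinj.
exists ps; split=> // [|u v]; first by apply: leq_trans hps _; apply: leq_pred.
rewrite !inE => /orP[/eqP ->|hu'] /orP[/eqP ->|hv'] // h.
- by have := hno _ hv'; rewrite /key h eqxx.
- by have := hno _ hu'; rewrite /key h eqxx.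
- exact: hinj.
Qed.

Lemma address_surjective L p : p < 2 ^ L -> exists2 bs, size bs = L & address bs = p.
Proof.
elim: L p => [|L IH] p hp; first by exists [::]; move: hp; case: p.
have [|bs hs ha] := IH (p %/ 2); first by rewrite expnS in hp; lia.
exists (rcons bs (odd p)); first by rewrite size_rcons hs.
rewrite /address -cats1 foldl_cat /= -/(address bs) ha; lia.
Qed.

(** Pigeonhole principle, by induction on the list of values: a value with a small fiber is removed
    together with that fiber. *)
Lemma large_fiber (T T' : eqType) (f : T -> T') (c : seq T') (s : seq T) N :
  (forall z, z \in s -> f z \in c) -> size c * N < size s ->
  exists v, N < size [seq z <- s | f z == v].
Proof.
elim: c s => [|v c IH] s hf hs;
  first by case: s hf hs => //= z s /(_ z); rewrite mem_head => /(_ isT).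
have [h|h] := ltnP N (size [seq z <- s | f z == v]); first by exists v.
have [||w hw] := IH [seq z <- s | f z != v].
- by move=> z; rewrite mem_filter => /andP[hz /hf]; rewrite inE (negPf hz).
- have := count_predC (fun z => f z == v) s; rewrite !size_filter in h *.
  rewrite /= mulSn in hs.
  have -> : count (predC (fun z => f z == v)) s = count (fun z => f z != v) s by [].
  by lia.
- exists w; apply: leq_trans hw _; rewrite -filter_predI !size_filter; apply: sub_count => z /=.
  by case/andP.
Qed.

(** One pigeonhole argument per index, each at the cost of a factor [size c]. *)
Lemma common_values (I T T' : eqType) (f : I -> T -> T') (c : seq T')
    (js : seq I) (s : seq T) M : 0 < size c -> 0 < M ->
  (forall i z, f i z \in c) -> uniq s -> size c ^ size js * M <= size s ->
  exists s', [/\ uniq s', {subset s' <= s}, size s' = M &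
    forall i, i \in js -> {in s' &, forall z z', f i z = f i z'}].
Proof.
move=> hc hM hf; elim: js s => [|i js IH] s hu.
  rewrite expn0 mul1n => hs; exists (take M s); split=> //.
  - exact: take_uniq.
  - by move=> z; apply: mem_take.
  - by rewrite size_take_min; apply/minn_idPl.
rewrite /= expnS -mulnA => hs.
have [|v hv] := @large_fiber _ _ (f i) c s (size c ^ size js * M).-1 (fun z _ => hf i z).
  apply: leq_trans hs; rewrite ltn_pmul2l // ltn_predL muln_gt0 expn_gt0 hc.
  exact: hM.
have [|s' [hu' hss hsz hall]] := IH _ (filter_uniq (fun z => f i z == v) hu).
  by apply: leq_trans (leqSpred _) hv.
exists s'; split=> // [z /hss|j].
  by rewrite mem_filter => /andP[].
rewrite inE => /orP[/eqP -> z z' /hss hz /hss hz'|/hall //].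
by move: hz hz'; rewrite !mem_filter => /andP[/eqP -> _] /andP[/eqP -> _].
Qed.

Fixpoint words (t : nat) : seq bitseq :=
  if t is t'.+1
  then [::] :: map (cons true) (words t') ++ map (cons false) (words t')
  else [::].

Lemma size_words t : (size (words t)).+1 = 2 ^ t.
Proof. by elim: t => //= t IH; rewrite size_cat !size_map expnS -IH mul2n -addnn addSn addnS. Qed.

Lemma mem_words t w : size w < t -> w \in words t.
Proof.
elim: t w => // t IH [|b w] hw //=; rewrite inE /= mem_cat.
by case: b hw => hw; apply/orP; [left|right]; apply/map_f/IH.
Qed.

(* The numbers of Turing machines in the enumeration underlying [univ] start at 4,
   because [pickle] of a pair is the code of a sequence of length two. *)
Lemma pickle_TM_gt2 (M : TM) : 2 < pickle M.
Proof.
case: M => qm t; rewrite /pickle /= /pickle_tagged /=.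
set a := pickle _; set b := pickle _.
rewrite /CodeSeq.code /= muln1.
by have := expn_gt0 2 a; have := expn_gt0 2 b; nia.
Qed.

(** A program on which the universal machine halts starts with four ones, by [pickle_TM_gt2]; if its
    length is at most s, fewer than s - 3 bits follow. This leaves 2^(s-3) - 1 candidates, and the
    factor 8 gained over 2^s pays for the encoding overhead in [length_bounds]. *)
Definition short_programs (s : nat) : seq bitseq :=
  [seq nseq 4 true ++ e | e <- words (s - 3)].

Lemma short_programsP e z u s : univ e z u -> size e <= s -> e \in short_programs s.
Proof.
move=> [M [p [-> _]]] hs; rewrite size_cat size_nseq /= in hs.
have h3 := pickle_TM_gt2 M.
have -> : nseq (pickle M).+1 true ++ false :: p =
    nseq 4 true ++ (nseq (pickle M - 3) true ++ false :: p).
  by rewrite catA -nseqD; congr (nseq _ _ ++ _); lia.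
apply/map_f/mem_words; rewrite size_cat size_nseq /=; lia.
Qed.

Definition bob_sends (e z y w : bitseq) (b : bool) : Prop :=
  exists2 P : program_pair, univ e z (bit_pair P.1 P.2) & told P.2 w y (Send b).

(** The next bit is chosen classically. The message stays the same when Bob sends nothing or [e]
    describes no pair of programs, so it is defined for every [e] and the pigeonhole argument
    applies. *)
Definition bob_next (e z y w : bitseq) : bitseq :=
  if `[< bob_sends e z y w true >] then rcons w true
  else if `[< bob_sends e z y w false >] then rcons w false else w.

Definition bob_message (e z y : bitseq) (t : nat) : bitseq :=
  iter t (bob_next e z y) [::].

Lemma univ_program_pair e z (P Q : program_pair) :
  univ e z (bit_pair P.1 P.2) -> univ e z (bit_pair Q.1 Q.2) -> P = Q.
Proof.
case: P Q => [a b] [a' b'] h h'.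
by have [/= -> ->] := bit_pair_inj (univ_inj h h').
Qed.

Lemma bob_nextE e z y w b (P : program_pair) : univ e z (bit_pair P.1 P.2) ->
  told P.2 w y (Send b) -> bob_next e z y w = rcons w b.
Proof.
move=> hP hb; have sends_b c : bob_sends e z y w c -> c = b.
  by move=> [Q hQ]; rewrite (univ_program_pair hQ hP) => /(told_inj hb)[].
have hs : bob_sends e z y w b by exists P.
rewrite /bob_next; case: asboolP => [/sends_b -> //|nt].
case: asboolP => [/sends_b -> //|nf].
by case: b hs {hb sends_b} => /[dup] hs; [case: (nt hs)|case: (nf hs)].
Qed.

Lemma size_bob_message e z y t : size (bob_message e z y t) <= t.
Proof.
elim: t => //= t IH; rewrite /bob_next.
by do 2?case: asboolP => _; rewrite ?size_rcons //; apply: leqW.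
Qed.

Lemma bob_message_prefix e z y t t' : t <= t' ->
  prefix (bob_message e z y t) (bob_message e z y t').
Proof.
move/subnK <-; elim: (t' - t) => [|d IH]; first exact: prefix_refl.
apply: prefix_trans IH _; rewrite addSn /= /bob_next.
by do 2?case: asboolP => _; rewrite ?prefix_rcons ?prefix_refl.
Qed.

Section OneWay.
Variables (P : program_pair) (x y : bitseq).
Hypothesis silent : forall w, conversation P x y w -> forall b, ~ told P.1 w x (Send b).

(** Only [Conv_Bob] can extend the conversation, so apart from its length it does not depend on
    x. *)
Lemma conversation_message e z w : univ e z (bit_pair P.1 P.2) ->
  conversation P x y w -> w = bob_message e z y (size w).
Proof.
move=> hP; elim=> [//|w' b hw' _ ha _|w' b hw' IH ha hb].
  by case: (silent hw' ha).
by rewrite size_rcons /= -IH (bob_nextE hP hb).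
Qed.

(** Excludes that Alice halts after a proper prefix of a conversation. *)
Lemma conversation_waits w j : conversation P x y w -> j < size w ->
  told P.1 (take j w) x Wait.
Proof.
move=> hw; elim: hw j => [//|w' b hw' _ ha _|w' b hw' IH ha hb] j.
  by case: (silent hw' ha).
rewrite size_rcons ltnS leq_eqVlt => /orP[/eqP ->|hj].
  by rewrite -cats1 take_size_cat.
by rewrite -cats1 takel_cat ?(ltnW hj) //; apply: IH.
Qed.

End OneWay.

(* With the same message from Bob, Alice halts after the same prefix of it. *)
Lemma one_way_output e z n (P Q : program_pair) (x y y' : n.-tuple bool) w w' t :
  univ e z (bit_pair P.1 P.2) -> univ e z (bit_pair Q.1 Q.2) ->
  one_way_protocol n P ->
  bob_message e z y t = bob_message e z y' t ->
  conversation P x y w -> told P.1 w x (Halt y) -> size w <= t ->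
  conversation Q x y' w' -> told Q.1 w' x (Halt y') -> size w' <= t -> y = y'.
Proof.
move=> hP hQ hone hm hw hh hs; rewrite (univ_program_pair hQ hP) => hw' hh' hs'.
have hone' v := proj2 hone x v.
have prefix_message (v : n.-tuple bool) u : conversation P x v u -> size u <= t ->
    u = take (size u) (bob_message e z v t).
  move=> hu hut; have /(bob_message_prefix e z v) := hut.
  by rewrite -(conversation_message (hone' v) hP hu) prefixE => /eqP.
have ew := prefix_message _ _ hw hs; have ew' := prefix_message _ _ hw' hs'.
rewrite -hm in ew'.
have take_le u v : u = take (size u) (bob_message e z y t) ->
    v = take (size v) (bob_message e z y t) -> size u <= size v ->
    u = take (size u) v.
  by move=> hu {2}-> huv; rewrite take_takel.
(* Both conversations are prefixes of the same message. If the lengths differ, Alice is told both to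
   halt and to wait after the shorter one; if they agree, her two outputs coincide. *)
have [lt_ww'|lt_w'w|eq_ww'] := ltngtP (size w) (size w').
- have := conversation_waits (hone' y') hw' lt_ww'.
  by rewrite -(take_le _ _ ew ew' (ltnW lt_ww')) => /(told_inj hh).
- have := conversation_waits (hone' y) hw lt_w'w.
  by rewrite -(take_le _ _ ew' ew (ltnW lt_w'w)) => /(told_inj hh').
- have eww' : w = w' by rewrite ew' -eq_ww'; exact: ew.
  rewrite -eww' in hh'.
  by have [yy'] := told_inj hh hh'; apply/val_inj.
Qed.

(** * Hard strings and length estimates *)

Definition pad (n : nat) (z : bitseq) : n.-tuple bool :=
  [tuple nth false z i | i < n].

Lemma nth_pad n z i : i < n -> nth false (pad n z) i = nth false z i.
Proof. by move=> hi; rewrite -[i]/(val (Ordinal hi)) -tnth_nth tnth_mktuple. Qed.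

Lemma val_pad n z : size z <= n -> pad n z = z ++ nseq (n - size z) false :> bitseq.
Proof.
move=> hz; apply: (@eq_from_nth _ false).
  by rewrite size_tuple size_cat size_nseq subnKC.
move=> i; rewrite size_tuple => hi; rewrite nth_pad // nth_cat.
by case: ltnP => // h; rewrite nth_default // nth_nseq if_same.
Qed.

Lemma pad_inj n k z z' : k <= n -> size z = k -> size z' = k ->
  pad n z = pad n z' -> z = z'.
Proof.
move=> hn hz hz' /(congr1 val) /= h; apply: (@eq_from_nth _ false) => [|i hi].
  by rewrite hz.
have hin : i < n by apply: leq_trans hn; rewrite -hz.
by rewrite -(nth_pad z hin) -(nth_pad z' hin); congr nth.
Qed.

(** There is one string more than there are short programs, and each program serves at most one of
    the strings. The list [zs] is chosen before x, since x will encode it. *)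
Lemma hard_inputs n k l s : k <= n -> 0 < l -> s + l * 2 ^ s <= k ->
  exists zs : seq bitseq, [/\ uniq zs, size zs = 2 ^ (s - 3),
    (forall z, z \in zs -> size z = k) &
    forall x : n.-tuple bool, exists2 z, z \in zs &
      forall e P w, one_way_protocol n P ->
        univ e (nseq n true) (bit_pair P.1 P.2) -> size e <= s ->
        conversation P x (pad n z) w -> told P.1 w x (Halt (pad n z)) ->
        l <= size w].
Proof.
move=> hkn hl hk; set u := nseq n true.
(* A conversation of fewer than l bits is a prefix of the message of at most l - 1 bits, and there
   are fewer than 2^l such messages. *)
pose f e z := bob_message e u (pad n z) l.-1.
pose all_z := [seq val z | z <- enum {: k.-tuple bool}].
have hc : 0 < size (words l).
  by rewrite -ltnS size_words -[2]/(2 ^ 1) leq_exp2l.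
have hM : 0 < 2 ^ (s - 3) by rewrite expn_gt0.
have hf e z : f e z \in words l.
  by apply: mem_words; rewrite -[l in _ < l]prednK // ltnS size_bob_message.
have hu : uniq all_z by rewrite map_inj_uniq ?enum_uniq //; apply: val_inj.
have hz z : z \in all_z -> size z = k.
  by case/mapP => t _ ->; rewrite size_tuple.
have sz : size (short_programs s) = (2 ^ (s - 3)).-1.
  by rewrite size_map -size_words.
(* Here the hypothesis on k enters: at most (2^l)^(2^s) combinations of messages, times 2^s, is at
   most 2^k. *)
have hs : size (words l) ^ size (short_programs s) * 2 ^ (s - 3) <= size all_z.
  have -> : size all_z = 2 ^ k by rewrite size_map -cardT card_tuple card_bool.
  apply: leq_trans (_ : (2 ^ l) ^ (2 ^ s) * 2 ^ s <= _); last first.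
    by rewrite -expnM -expnD leq_exp2l // addnC.
  apply: leq_mul; last by rewrite leq_exp2l // leq_subr.
  apply: leq_trans (_ : (2 ^ l) ^ size (short_programs s) <= _).
    have le_words : size (words l) <= 2 ^ l by rewrite -size_words.
    by elim: (size (short_programs s)) => // e IHe; rewrite !expnS leq_mul.
  rewrite leq_pexp2l ?expn_gt0 // sz.
  by apply: leq_trans (leq_pred _) _; rewrite leq_exp2l // leq_subr.
have [zs [hzu hzs hsz hall]] := common_values hc hM hf hu hs.
exists zs; split=> // [z /hzs/hz //|x].
apply/exists2P; apply: contrapT => hno.
(* If every string of [zs] were output early, choosing a program for each would inject [zs] into the
   shorter list [short_programs s]. *)
pose good z e := exists P w, [/\ one_way_protocol n P, univ e u (bit_pair P.1 P.2),
  size e <= s, conversation P x (pad n z) w /\ told P.1 w x (Halt (pad n z)) & size w < l].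
have [g hg] : {g & forall z, z \in zs -> good z (g z)}.
  apply: (@choice _ _ (fun z e => z \in zs -> good z e)) => z.
  have [hzz|hzz] := boolP (z \in zs); last by exists [::].
  apply: contrapT => hne; apply: hno; exists z; split=> // e P w h1 h2 h3 h4 h5.
  rewrite leqNgt; apply/negP => h6; apply: hne; exists e => _.
  by exists P, w; split.
have ginj : {in zs &, injective g}.
  move=> z z' hzz hzz' eg.
  have [P [w [h1 h2 h3 [h4 h5] h6]]] := hg _ hzz.
  have [Q [w' [h1' h2' h3' [h4' h5'] h6']]] := hg _ hzz'.
  rewrite -eg in h2'.
  apply: (pad_inj hkn); [by apply/hz/hzs|by apply/hz/hzs|].
  have le_l v : size v < l -> size v <= l.-1 by move=> hv; rewrite -ltnS prednK.
  have hm := hall _ (short_programsP h2 h3) _ _ hzz hzz'.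
  exact: (one_way_output h2 h2' h1 hm h4 h5 (le_l _ _ h6) h4' h5' (le_l _ _ h6')).
have /(uniq_leq_size _) : {subset [seq g z | z <- zs] <= short_programs s}.
  move=> e /mapP[z hzz ->]; have [P [w [_ h2 h3 _ _]]] := hg _ hzz.
  exact: short_programsP h2 h3.
by rewrite map_inj_in_uniq // => /(_ hzu); rewrite size_map hsz sz leqNgt ltn_predL hM.
Qed.

(** The first inequality is for the length of the conversation, the second for the room in x: M - 1
    queries of L-bit addresses, the closing pair, and M table entries with keys of M - 1 bits. *)
Lemma length_bounds k s : 0 < s -> s + 2 ^ s <= k ->
  let L := trunc_log 2 (2 * k) in let M := 2 ^ (s - 3) in
  M.-1 * (2 * L + 3) + 2 <= 2 ^ s * L /\
  M.-1 * (2 * L + 2) + 2 + M * (M.-1 + (2 * k + 1)) <= (2 ^ s + 1) * k.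
Proof.
move=> hs hk L M; have hk0 : 0 < k by apply: leq_trans hk; rewrite addn_gt0 hs.
have hL : 0 < L by rewrite /L trunc_log_gt0 /=; lia.
have hLk : L <= k.
  have h2L : 2 ^ L <= 2 * k by apply: trunc_logP => //; lia.
  have : 2 * L <= 2 ^ L.
    elim: (L) => // -[|n] // IH; rewrite expnS; lia.
  lia.
(* For s at most 3 the truncated subtraction gives M = 1: nothing is asked and the table has a
   single entry. *)
have [le_s3|lt_3s] := leqP s 3.
  have -> : M = 1 by rewrite /M (eqP le_s3).
  have := expn_gt0 2 s; have : 2 ^ 1 <= 2 ^ s by rewrite leq_exp2l.
  by rewrite /= => h2 _; split; nia.
have hM : 2 ^ s = 8 * M by rewrite -[8]/(2 ^ 3) -expnD subnKC // ltnW.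
have hM0 : 0 < M by rewrite expn_gt0.
rewrite hM; have hMk : 8 * M <= k by rewrite -hM; lia.
have -> : M.-1 = M - 1 by rewrite subn1.
split.
  have -> : 8 * M * L = (M - 1) * (8 * L) + 8 * L by nia.
  apply: leq_add; last by lia.
  by apply: leq_mul => //; lia.
have h1 : (M - 1) * (2 * L + 2) <= M * (4 * k) by apply: leq_mul; lia.
have h2 : M * (M - 1 + (2 * k + 1)) <= M * (3 * k) by apply: leq_mul; lia.
nia.
Qed.

(** * Encoding of the queries and the table in x *)

Lemma size_payload z : size (payload z) = 2 * size z + 1.
Proof. by rewrite size_cat; elim: z => //= b z; lia. Qed.

Lemma size_query bs : size (query bs) = 2 * size bs + 2.
Proof. by rewrite size_cat; elim: bs => //= b bs; lia. Qed.

Lemma size_flatten_const (T : eqType) (A : Type) (f : T -> seq A) (s : seq T) m :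
  (forall t, t \in s -> size (f t) = m) -> size (flatten (map f s)) = size s * m.
Proof.
elim: s => //= t s IH h; rewrite size_cat h ?mem_head // IH // => u hu.
by apply: h; rewrite inE hu orbT.
Qed.

Lemma table_input n k L (zs : seq bitseq) : k <= n -> k <= 2 ^ L -> 0 < size zs ->
  uniq zs -> (forall z, z \in zs -> size z = k) ->
  (size zs).-1 * (2 * L + 2) + 2 + size zs * ((size zs).-1 + (2 * k + 1)) <= n ->
  exists x : n.-tuple bool, forall z, z \in zs -> exists2 w,
    conversation protocol x (pad n z) w /\ told protocol.1 w x (Halt (pad n z)) &
    size w <= (size zs).-1 * (2 * L + 3) + 2.
Proof.
move=> hkn hkL hzs0 hu hz hn.
have [ps [hps hlt hinj]] := separating_positions hu hz.
have [ad had] : {ad & forall p, p < k -> size (ad p) = L /\ address (ad p) = p}.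
  apply: (@choice _ _ (fun p bs => p < k -> size bs = L /\ address bs = p)) => p.
  have [hp|hp] := ltnP p k; last by exists [::].
  have [bs hs hb] := address_surjective (leq_trans hp hkL).
  by exists bs.
pose qs := map ad ps.
(* Reversed, because [scan] collects the replies with the latest first. *)
pose key z := rev [seq nth false z p | p <- ps].
pose es := [seq (key z, z) | z <- zs].
pose v := flatten (map query qs) ++ [:: false, false & flatten (map entry es)].
have hqs bs : bs \in qs -> size bs = L by case/mapP => p /hlt /had[<- _] ->.
have size_v : size v <= n.
  apply: leq_trans hn; rewrite size_cat /= (@size_flatten_const _ _ query _ (2 * L + 2)).
    rewrite (@size_flatten_const _ _ entry _ (size ps + (2 * k + 1))); last first.
      move=> e /mapP[z hzz ->]; rewrite size_cat size_payload /= size_rev size_map.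
      by rewrite hz.
    rewrite !size_map -addnA leq_add ?leq_mul //.
    by rewrite -[_.+2]/(2 + _) leq_add2l leq_mul2l leq_add2r hps orbT.
  by move=> bs /hqs hbs; rewrite size_query hbs.
have size_x : size (v ++ nseq (n - size v) false) == n.
  by rewrite size_cat size_nseq subnKC.
exists (Tuple size_x) => z hzz.
set y := pad n z; have hkey : rev (key z) = [seq nth false y (address bs) | bs <- qs].
  rewrite /key revK /qs -map_comp; apply/eq_in_map => p /hlt hp /=.
  by rewrite (proj2 (had _ hp)) nth_pad // (leq_trans hp).
have [|w [a [hw hs hx hsz]]] := @conversation_queries
    (v ++ nseq (n - size v) false) y qs L [::] 0 [::]
    (flatten (map entry es) ++ nseq (n - size v) false) hqs (Conv_nil _ _ _) erefl.
  by rewrite drop0 /v -catA.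
exists w; last first.
  by rewrite hsz add0n size_map leq_add2r leq_mul2r hps orbT.
split=> //; have := told_alice w (v ++ nseq (n - size v) false).
have halt : run 6 alice [::] (bit_pair w (v ++ nseq (n - size v) false)) = true :: y.
  rewrite (@run_alice_halt w _ es z (n - size v)) ?hs //=.
  - by rewrite (eqP size_x) val_pad // hz.
  - rewrite -map_comp map_inj_in_uniq // => z1 z2 h1 h2 /= /(can_inj revK).
    exact: hinj.
  - move=> e /mapP[z' _ ->] /=.
    by rewrite -/(rev _) !size_rev !size_map.
  - by rewrite -/(rev _) -hkey revK; apply: map_f.
by rewrite /instruction_A hs /= halt.
Qed.

(** * Passage to extended reals and conclusion *)

Import Order.TTheory GRing.Theory Num.Theory.

(** If no element of [A] were at most s, then s + 1 would be a lower bound. *)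
Lemma nat_min_le (R : realType) (A : set nat) (s : nat) :
  (nat_min R A <= s%:R%:E)%E -> exists2 i, A i & i <= s.
Proof.
move=> h; apply/exists2P; apply: contrapT => hno.
have : (s.+1%:R%:E <= nat_min R A)%E.
  apply/ereal_infP => _ [i hi <-]; rewrite lee_fin ler_nat ltnNge.
  by apply/negP => his; apply: hno; exists i.
by move=> /le_trans/(_ h); rewrite lee_fin ler_nat ltnn.
Qed.

Lemma trunc_log_log2 (R : realType) m : 0 < m ->
  ((trunc_log 2 m)%:R <= log2 m%:R :> R)%R.
Proof.
move=> hm; rewrite /log2 ler_pdivlMr ?ln_gt0 ?ltr1n //.
rewrite mulr_natl -lnXn ?ltr0n // ler_ln ?posrE ?exprn_gt0 ?ltr0n //.
by rewrite -natrX ler_nat trunc_logP.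
Qed.

Theorem theorem8 (R : realType) :
  exists c : nat, forall k l s : nat,
    (0 < k)%N -> (0 < l)%N -> (0 < s)%N -> (s + l * 2 ^ s <= k)%N ->
    exists x y : ((2 ^ s + 1) * k).-tuple bool,
      (CC R Id_fun c x y <= ((2 ^ s)%N%:R * log2 (2 * k)%N%:R)%R%:E)%E /\
      (l%:R%:E <= PCC_one_way R Id_fun s x y)%E.
Proof.
(* This program prints the protocol whatever the condition is, so its length serves as the constant
   for all k, l, s. *)
pose e0 := program (push_all (bit_pair protocol.1 protocol.2)).
exists (size e0) => k l s hk hl hs hkls; set n := (2 ^ s + 1) * k.
have hkn : k <= n by rewrite leq_pmull // addn1.
have [zs [hu hsz hz hlow]] := hard_inputs hkn hl hkls.
have hks : s + 2 ^ s <= k.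
  by apply: leq_trans hkls; rewrite leq_add2l leq_pmull.
have [hlen hsize] := length_bounds hs hks.
set L := trunc_log 2 (2 * k) in hlen hsize.
have hkL : k <= 2 ^ L.
  have := @trunc_log_ltn 2 (2 * k) isT.
  by rewrite -/L expnS ltn_pmul2l // => /ltnW.
have [||x hx] := table_input hkn hkL _ hu hz.
- by rewrite hsz expn_gt0.
- by rewrite hsz.
(* The string x lets Alice recover every element of [zs], so the element that is hard for this x can
   be picked afterwards. *)
have [z hzz hfail] := hlow x; exists x, (pad n z); split.
- have [w hw hwsz] := hx z hzz.
  apply: (@le_trans _ _ (CC_of R Id_fun protocol x (pad n z))).
    apply: ereal_inf_lbound; exists protocol => //; split.
      exact: total_protocol_protocol.
    apply: ereal_inf_lbound; exists (size e0) => //; exists e0 => //.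
    rewrite /= -[X in univ _ _ X](run_push_all _ [::] (nseq n true)).
    exact/univ_program/wf_push_all.
  apply: (@le_trans _ _ ((size w)%:R%:E)).
    by apply: ereal_inf_lbound; exists (size w) => //; exists w.
  rewrite lee_fin; apply: le_trans (_ : ((2 ^ s * L)%N%:R <= _)%R).
    by rewrite ler_nat (leq_trans hwsz) // hsz.
  by rewrite natrM ler_wpM2l ?ler0n // trunc_log_log2 // muln_gt0.
- apply/ereal_infP => _ [P [hP hC] <-].
  apply/ereal_infP => _ [_ [w [hw hh] <-] <-]; rewrite lee_fin ler_nat.
  have [_ [e he <-] hes] := nat_min_le hC.
  exact: hfail hP he hes hw hh.
Qed.
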